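(* If $G$ is a bicyclic graph of order $n\ge 7$, then $\operatorname{CW}(G,x)\preceq \operatorname{CW}(B_n,x)$.
   Context: All graphs are finite, simple and undirected. A bicyclic graph is a connected graph $G$ with $|E(G)|=|V(G)|+1$. $B_n$ is the graph with vertices $c,a,b,w$ and $n-4$ further vertices, where $c$ is adjacent to all other vertices and the only other edges are $ab$ and $aw$. A graph is cop-win if, in the game of Cops and Robber with one cop (cop places, then robber places, then they alternately move to an adjacent vertex or stay put; the cop wins on occupying the robber's vertex), the cop can guarantee capture. For a graph $G$ of order $n$, $W_k(G)$ is the number of $k$-subsets of $V(G)$ inducing a cop-win subgraph, and the cop-win polynomial is $\operatorname{CW}(G,x)=\sum_{k=1}^n W_k(G)x^k$. For polynomials $A(x)=\sum_{k=0}^n a_kx^k$, $B(x)=\sum_{k=0}^m b_kx^k$, write $B(x)\preceq A(x)$ if $m\le n$ and $b_k\le a_k$ for all $k$. *)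

(* Defs.v *)
From mathcomp Require Import all_boot all_order all_algebra.
From mathcomp Require Import boolp.

Set Implicit Arguments.
Unset Strict Implicit.
Unset Printing Implicit Defensive.

Import Order.TTheory GRing.Theory Num.Theory.

Local Open Scope ring_scope.

Record sgraph := SGraph {
  vertex :> finType;
  adj : rel vertex;
  adj_sym : symmetric adj;
  adj_irrefl : irreflexive adj }.

Definition edges (G : sgraph) : {set {set G}} :=
  [set [set p.1; p.2] | p : G * G & adj p.1 p.2].

Definition connected (G : sgraph) : Prop :=
  (0 < #|G|)%N /\ forall x y : G, connect (@adj G) x y.

Definition bicyclic (G : sgraph) : Prop :=
  connected G /\ #|edges G| = #|G|.+1.

Section Induced.
Variables (G : sgraph) (S : {set G}).

Definition induced_adj : rel {x : G | x \in S} :=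
  fun u v => adj (val u) (val v).

Lemma induced_adj_sym : symmetric induced_adj.
Proof. by move=> u v; exact: adj_sym. Qed.

Lemma induced_adj_irrefl : irreflexive induced_adj.
Proof. by move=> u; exact: adj_irrefl. Qed.

Definition induced : sgraph := SGraph induced_adj_sym induced_adj_irrefl.
End Induced.

Section Game.
Variable G : sgraph.

Definition legal_move (x y : G) : bool := (x == y) || adj x y.

(* [r 0] is the robber's initial placement, [r n] its position after n moves. *)
Definition robber_play (r : nat -> G) : Prop :=
  forall n, legal_move (r n) (r n.+1).

(* A cop strategy maps the list of past robber positions (oldest first) to the
   next cop position; [sigma [::]] is the cop's initial placement.  The order
   of play is [cop_pos 0, r 0, cop_pos 1, r 1, ...]; in particular
   [cop_pos n] depends only on [r 0, ..., r (n - 1)].  The past cop positions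
   are determined by [sigma] and the past robber positions. *)
Definition cop_pos (sigma : seq G -> G) (r : nat -> G) (n : nat) : G :=
  sigma (mkseq r n).

Definition legal_strategy (sigma : seq G -> G) : Prop :=
  forall r, robber_play r ->
  forall n, legal_move (cop_pos sigma r n) (cop_pos sigma r n.+1).

(* The two disjuncts: the robber has placed itself on or moved onto the cop's
   vertex, or the cop has moved onto the robber's vertex. *)
Definition captures (sigma : seq G -> G) (r : nat -> G) : Prop :=
  exists n, cop_pos sigma r n = r n \/ cop_pos sigma r n.+1 = r n.

(* A graph without vertices is not cop-win: it admits no [sigma]. *)
Definition cop_win : Prop :=
  exists2 sigma : seq G -> G, legal_strategy sigma &
    forall r, robber_play r -> captures sigma r.
End Game.

Definition cw_count (G : sgraph) (k : nat) : nat :=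
  #|[set S : {set G} | (#|S| == k) && `[< cop_win (induced S) >]]|.

Definition cw_poly (G : sgraph) : {poly int} :=
  \sum_(1 <= k < #|G|.+1) (cw_count G k)%:R *: 'X^k.

(* [size p] is the degree plus one, and [p`_k = 0] beyond the degree. *)
Definition coef_le (B A : {poly int}) : Prop :=
  (size B <= size A)%N /\ forall k : nat, B`_k <= A`_k.

Notation "B ⪯ A" := (coef_le B A) (at level 70, no associativity).

(* The vertices c, a, b, w are 0, 1, 2, 3; meaningful for n >= 4 only. *)
Section Bn.
Variable n : nat.

Definition Bn_half (i j : 'I_n) : bool :=
  [|| (i == 0 :> nat)%N && (j != 0 :> nat)%N,
      (i == 1 :> nat)%N && (j == 2 :> nat)%N |
      (i == 1 :> nat)%N && (j == 3 :> nat)%N].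

Definition Bn_adj : rel 'I_n := fun i j => Bn_half i j || Bn_half j i.

Lemma Bn_adj_sym : symmetric Bn_adj.
Proof. by move=> i j; rewrite /Bn_adj orbC. Qed.

Lemma Bn_adj_irrefl : irreflexive Bn_adj.
Proof. by case=> [] [|[|i]] Hi. Qed.

Definition Bn : sgraph := SGraph Bn_adj_sym Bn_adj_irrefl.
End Bn.

(* Main.v *)
(* A set S of vertices of G is called good if it is connected and the robber has
   no set of vertices in which to live forever; cop-win sets are good.  Sets with
   a dominating vertex are cop-win, so W_k(B_n) is at least the number C(n-1,k-1)
   of k-sets containing c (plus {a,b,w} if k = 3).

   Let c be a vertex of G such that G - c is a forest.  A good k-set S avoiding c
   has a leaf s; if s is not adjacent to c, replacing the neighbour of s by c
   isolates s, and gives a bad set containing c.  The forest condition makes this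
   map injective, so the number of good k-sets is at most C(n-1,k-1), up to the
   few exceptional S all of whose leaves are adjacent to c, i.e. the cycles
   through c with c removed.  These are compensated by bad sets containing c
   which are not in the image of the map.  This handles leafless graphs without
   bridges; across a bridge (in particular at a leaf) the count is subadditive,
   which gives an induction on n.  The case k = 3 is a direct count. *)
Require Import Defs.
From mathcomp Require Import all_boot all_order all_algebra.
From mathcomp Require Import boolp zify.

Set Implicit Arguments.
Unset Strict Implicit.
Unset Printing Implicit Defensive.

(** Only upper bounds are needed for [G], so being cop-win can be relaxed to being good, which is
    refuted by disconnectedness or by a cycle of length at least four in which the robber lives.
    Structure is extracted from degree sums: a connected set has at least |S| - 1 edges, a forest at
    most that many. In a leafless bicyclic graph the degrees exceed 2 by 2 in total, so there is one
    vertex of degree four, or there are two vertices [P] and [Q] of degree three. In the second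
    case, without a bridge, three paths join [P] to [Q], and [P] serves as c. With a bridge, two
    disjoint cycles occur; no vertex lies on both, so no single c leaves a forest, and each side of
    the bridge gets its own. The obstacle is the supply of spare bad sets: on six vertices with k =
    4, one exceptional set may stay uncompensated. Adding a leaf to such a graph absorbs the excess,
    which is where n >= 7 enters for k > 3. *)

Ltac nlia :=
  repeat match goal with
  | H : is_true (leq _ _) |- _ => revert H
  | H : is_true (leq _ _ && leq _ _) |- _ => revert H
  | H : @eq nat _ _ |- _ => revert H
  end; clear; lia.

(** * Counting edges *)

Section Degrees.
Variable G : sgraph.
Implicit Types (A B C S T X Y Z : {set G}) (x y z c p q r s h : G).

Definition nb A x := #|[set y in A | adj x y]|.
(** Counts ordered adjacent pairs, so an edge with both ends in A and B counts twice: [vol A] is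
    twice the number of edges inside A, while [boundary A X] counts each edge leaving X once. *)
Definition dsum A B := \sum_(x in A) nb B x.
Definition vol A := dsum A A.
Definition boundary A X := dsum X (A :\: X).

Lemma nbE A x : nb A x = \sum_(y in A) adj x y.
Proof.
rewrite /nb -sum1_card (eq_bigl (fun y => (y \in A) && adj x y)) => [|y]; last by rewrite inE.
by rewrite big_mkcondr; apply: eq_bigr => y _; case: adj.
Qed.

Lemma nb0P A x : reflect (forall y, y \in A -> ~~ adj x y) (nb A x == 0).
Proof.
rewrite cards_eq0; apply: (iffP eqP) => [e0 y yA|h].
  by apply/negP => xy; have := in_set0 y; rewrite -e0 inE yA xy.
by apply/setP => y; rewrite !inE; apply/negP => /andP[/h/negP].
Qed.

Lemma nb_gt0P A x : reflect (exists2 y, y \in A & adj x y) (0 < nb A x).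
Proof.
apply: (iffP card_gt0P) => [[y]|[y yA xy]]; first by rewrite inE => /andP[]; exists y.
by exists y; rewrite inE yA.
Qed.

Lemma nbD1 A x y : y \in A -> nb A x = adj x y + nb (A :\ y) x.
Proof. by move=> yA; rewrite !nbE (big_setD1 y yA). Qed.

Lemma nbU1 A x y : y \notin A -> nb (y |: A) x = adj x y + nb A x.
Proof. by move=> yA; rewrite !nbE big_setU1. Qed.

Lemma nb_self A x : nb (A :\ x) x = nb A x.
Proof.
have [xA|xA] := boolP (x \in A); first by rewrite [RHS](nbD1 _ xA) adj_irrefl.
by rewrite (setDidPl _) // disjoint_sym disjoints1.
Qed.


Lemma nbID A X x : nb A x = nb (A :&: X) x + nb (A :\: X) x.
Proof. by rewrite !nbE (big_setID X). Qed.

Lemma nb_split A X x : X \subset A -> nb A x = nb X x + nb (A :\: X) x.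
Proof. by move=> /setIidPr XA; rewrite (nbID A X) XA. Qed.

Lemma nbS A B x : A \subset B -> nb A x <= nb B x.
Proof. by move=> /nb_split->; rewrite leq_addr. Qed.

Lemma dsumC A B : dsum A B = dsum B A.
Proof.
rewrite /dsum (eq_bigr (fun x => \sum_(y in B) adj x y)) => [|x _]; last exact: nbE.
rewrite exchange_big; apply: eq_bigr => y _; rewrite nbE.
by apply: eq_bigr => x _; rewrite adj_sym.
Qed.

Lemma dsum_splitr A B X : X \subset B -> dsum A B = dsum A X + dsum A (B :\: X).
Proof. by move=> XB; rewrite /dsum -big_split; apply: eq_bigr => x _; apply: nb_split. Qed.

Lemma dsum_splitl A B X : X \subset A -> dsum A B = dsum X B + dsum (A :\: X) B.
Proof. by move=> XA; rewrite dsumC (dsum_splitr _ XA) !(dsumC B). Qed.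

Lemma dsum1 x B : dsum [set x] B = nb B x.
Proof. by rewrite /dsum big_set1. Qed.

Lemma dsum_boundary A X : X \subset A -> dsum X A = vol X + boundary A X.
Proof. exact: dsum_splitr. Qed.

Lemma volD1 A x : x \in A -> vol A = vol (A :\ x) + (nb A x).*2.
Proof.
move=> xA; have sxA : [set x] \subset A by rewrite sub1set.
rewrite /vol (dsum_splitl _ sxA) dsum1 (dsum_splitr (A :\ x) sxA) (dsumC _ [set x]) dsum1 nb_self.
nlia.
Qed.

Lemma volU1 A x : x \notin A -> vol (x |: A) = vol A + (nb A x).*2.
Proof.
move=> xA; rewrite (@volD1 _ x) ?setU11 // setU1K // nbU1 // adj_irrefl.
by [].
Qed.

Lemma dsum_gt0P A B : reflect (exists x y, [/\ x \in A, y \in B & adj x y]) (0 < dsum A B).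
Proof.
apply: (iffP idP) => [|[x [y [xA yB xy]]]].
  rewrite lt0n => /negP h; apply: contrapT => hn; apply: h.
  rewrite sum_nat_eq0; apply/forall_inP => x xA; apply/nb0P => y yB.
  by apply/negP => xy; apply: hn; exists x, y.
rewrite /dsum (bigD1 x) //= ltn_addr //; apply/nb_gt0P; by exists y.
Qed.

Lemma dsum_eq1 A B : dsum A B = 1 -> exists x y, [/\ x \in A, y \in B, adj x y &
  forall x' y', x' \in A -> y' \in B -> adj x' y' -> x' = x /\ y' = y].
Proof.
move=> d1; have /dsum_gt0P[x [y [xA yB xy]]] : 0 < dsum A B by rewrite d1.
exists x, y; split=> // x' y' x'A y'B x'y'.
have sx : [set x] \subset A by rewrite sub1set.
have sy : [set y] \subset B by rewrite sub1set.
have nx : 0 < nb B x by apply/nb_gt0P; exists y.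
have xx' : x' = x.
  apply/eqP/negPn/negP => ne; move: d1; rewrite (dsum_splitl _ sx) dsum1 => d1.
  have : 0 < dsum (A :\ x) B by apply/dsum_gt0P; exists x', y'; rewrite !inE ne.
  by nlia.
split=> //; apply/eqP/negPn/negP => ne; move: d1.
rewrite (dsum_splitl _ sx) dsum1 (nbD1 _ yB) xy => d1.
have : 0 < nb (B :\ y) x by apply/nb_gt0P; exists y'; rewrite ?inE ?ne // -xx'.
by nlia.
Qed.

End Degrees.

(** * Connected sets and forests *)

Section Conn.
Variable G : sgraph.
Implicit Types (A B C S T X Y Z : {set G}) (x y z c p q r s h : G).

(** Connectedness without paths. X ranges over all vertex sets, not only subsets of S, so any
    convenient set closed within S can be tested. *)
Definition conn S := S != set0 /\ forall X x0, x0 \in X -> x0 \in S ->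
  (forall x y, x \in X -> x \in S -> y \in S -> adj x y -> y \in X) -> S \subset X.

(** Acyclicity as 1-degeneracy. Its failure yields a nonempty set of minimum degree two, a core,
    which plays the role of a cycle throughout. *)
Definition forest A := forall X, X \subset A -> X != set0 -> exists2 x, x \in X & nb X x <= 1.

(* The robber can stay in [C]: it has a safe starting vertex, and a safe move
   whenever it stands on [r] and the cop has just moved to [c] without capture. *)
Definition evasive C S := [/\ C \subset S,
  forall c, c \in S -> exists2 r, r \in C & (r != c) && ~~ adj c r &
  forall r c, r \in C -> c \in S -> c != r ->
    exists2 r', r' \in C & [&& (r == r') || adj r r', r' != c & ~~ adj c r']].

Definition good S := conn S /\ forall C, ~ evasive C S.

Lemma conn_nb_gt0 S s : conn S -> s \in S -> 1 < #|S| -> 0 < nb S s.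
Proof.
move=> [_ cS] sS S1; rewrite lt0n; apply/negP => /nb0P n0.
have /subset_leq_card : S \subset [set s]; last by rewrite cards1; nlia.
apply: (cS _ s) => //; first by rewrite inE.
by move=> x y /set1P-> _ yS sy; have := n0 y yS; rewrite sy.
Qed.

Lemma conn_boundary A X x y : conn A -> X \subset A -> x \in X -> y \in A -> y \notin X -> 0 <
  boundary A X.
Proof.
move=> [_ cA] XA xX yA yX; apply/dsum_gt0P; apply: contrapT => hn.
suff /subsetP/(_ y yA) : A \subset X by rewrite (negbTE yX).
apply: (cA X x xX (subsetP XA x xX)) => u v uX uA vA uv.
by apply/negPn/negP => vX; apply: hn; exists u, v; rewrite inE vX vA.
Qed.

(** A subset is grown vertex by vertex; each new vertex arrives with at least one edge. *)
Lemma vol_conn S : conn S -> #|S|.*2 <= vol S + 2.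
Proof.
move=> cS; suff H m : 0 < m <= #|S| -> exists X, [/\ X \subset S, #|X| = m & m.*2 <= vol X + 2].
  have S0 : 0 < #|S| by rewrite card_gt0; case: cS.
  have [|X [XS cX]] := H #|S|; first by rewrite S0 leqnn.
  suff -> : X = S by []. by apply/eqP; rewrite eqEcard XS cX leqnn.
elim: m => // -[|m] IH.
  move=> _; have [x xS] : exists x, x \in S by apply/set0Pn; case: cS.
  by exists [set x]; rewrite sub1set xS cards1; split=> //; nlia.
move=> mS; have [|X [XS cX volX]] := IH; first by nlia.
have /card_gt0P[x xX] : 0 < #|X| by nlia.
have /subsetPn[y0 y0S y0X] : ~~ (S \subset X) by apply/negP => /subset_leq_card; nlia.
have /dsum_gt0P[u [v [uX]]] := conn_boundary cS XS xX y0S y0X; rewrite inE => /andP[vX vS] uv.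
exists (v |: X); rewrite subUset sub1set vS XS cardsU1 vX cX volU1 //; split=> //.
have : 0 < nb X v by apply/nb_gt0P; exists u; rewrite // adj_sym.
nlia.
Qed.

Lemma forestS A B : B \subset A -> forest A -> forest B.
Proof. by move=> BA fA X XB; apply: fA; apply: subset_trans BA. Qed.

Lemma vol_forest A : forest A -> A != set0 -> vol A + 2 <= #|A|.*2.
Proof.
have [n] := ubnP #|A|; elim: n A => // n IH A An fA A0.
have [x xA nx] := fA _ (subxx A) A0.
have cA : #|A| = #|A :\ x|.+1 by rewrite (cardsD1 x A) xA.
have [e0|n0] := eqVneq (A :\ x) set0.
  rewrite (volD1 xA) -nb_self e0 cA e0 cards0 /vol /dsum big_set0 nbE big_set0 //.
have := IH _ _ (forestS (subD1set A x) fA) n0; rewrite (volD1 xA) => /(_ _); nlia.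
Qed.

(** Deleting v costs one vertex but at least two edges, leaving too few edges for a connected
    set. *)
Lemma forest_cut A v : forest A -> v \in A -> 1 < nb A v -> ~ conn (A :\ v).
Proof.
move=> fA vA nv /vol_conn.
have A0 : A != set0 by apply/set0Pn; exists v.
have := vol_forest fA A0; rewrite (volD1 vA).
rewrite (cardsD1 v A) vA; nlia.
Qed.

Lemma has_core A : A != set0 -> #|A|.*2 <= vol A ->
  exists X, [/\ X \subset A, X != set0 & forall x, x \in X -> 1 < nb X x].
Proof.
move=> A0 vA; apply: contrapT => hn.
have fA : forest A.
  move=> X XA X0; apply: contrapT => hx; apply: hn; exists X; split=> // x xX.
  by rewrite ltnNge; apply/negP => nx; apply: hx; exists x.
by have := vol_forest fA A0; nlia.
Qed.

(* Otherwise [z] and [z'] lie on a common cycle. *)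
Lemma join_unique A X s z z' : forest A -> z |: X \subset A -> z' |: X \subset A ->
  conn (z |: X) -> conn (z' |: X) -> z \notin X -> z' \notin X ->
  s \in X -> nb X s = 0 -> 1 < #|X| -> z = z'.
Proof.
move=> fA zA z'A cz cz' zX z'X sX ns X1; apply/eqP/negPn/negP => ne.
have sz' : adj s z'.
  have /nb_gt0P[y] : 0 < nb (z' |: X) s.
    by apply: conn_nb_gt0; rewrite ?inE ?sX ?orbT // cardsU1 z'X; nlia.
  by case/setU1P => [-> //|yX sy]; move/eqP/nb0P: ns => /(_ y yX); rewrite sy.
have [x xX xs] : exists2 x, x \in X & x != s.
  have /card_gt0P[x] : 0 < #|X :\ s| by move: X1; rewrite (cardsD1 s X) sX; nlia.
  by rewrite !inE => /andP[]; exists x.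
(* As s is isolated in X, the pair s, z' would be closed in [z' |: X] if s were the only neighbour
   of z' in X. *)
have n2 : 1 < nb X z'.
  rewrite (nbD1 _ sX) adj_sym sz' ltnS; apply/nb_gt0P; apply: contrapT => hn.
  suff /subsetP/(_ x) : z' |: X \subset [set s; z'].
    rewrite !inE xX orbT (negbTE xs) => /(_ isT)/eqP xz.
    by move: z'X; rewrite -xz xX.
  apply: (cz'.2 _ s); rewrite ?inE ?eqxx ?sX ?orbT // => u v.
  rewrite !inE => /orP[]/eqP-> _ /orP[/eqP->|vX uv]; rewrite ?eqxx ?orbT //.
    by move/eqP/nb0P: ns => /(_ v vX); rewrite uv.
  case: (v =P s) => //= vs; case: hn; exists v => //; rewrite !inE vX andbT; exact/eqP.
(* [z |: X] has at least |X| edges and z' adds two, so |X| + 2 vertices span at least |X| + 2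
   edges. *)
have U : z' |: (z |: X) \subset A by rewrite subUset zA andbT (subset_trans _ z'A) ?subsetUl.
have U0 : z' |: (z |: X) != set0 by apply/set0Pn; exists z'; rewrite setU11.
have := vol_forest (forestS U fA) U0; have := vol_conn cz.
have z'zX : z' \notin z |: X by rewrite !inE negb_or z'X eq_sym ne.
rewrite (volU1 z'zX) !cardsU1 z'zX zX; have := nbS z' (subsetUr [set z] X); nlia.
Qed.

End Conn.

(** * Counting good sets *)

Lemma card_supersets (T : finType) (A B : {set T}) k : B \subset A -> #|B| <= k ->
  #|[set S : {set T} | [&& S \subset A, #|S| == k & B \subset S]]| = 'C(#|A| - #|B|, k - #|B|).
Proof.
move=> BA Bk; have <- : #|A :\: B| = #|A| - #|B| by rewrite cardsD (setIidPr BA).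
rewrite -cards_draws -[RHS](card_in_imset (f := fun S => B :|: S)).
  apply: eq_card => S; rewrite inE; apply/and3P/imsetP => [[SA /eqP cS BS]|[X]].
    exists (S :\: B); last by rewrite -{1}(setID S B) (setIidPr BS).
    by rewrite inE setSD //= cardsD (setIidPr BS) cS.
  rewrite inE subsetD => /andP[/andP[XA dX] /eqP cX] ->.
  by rewrite subUset BA XA subsetUl cardsU disjoint_setI0 1?disjoint_sym // cards0 cX subn0
    subnKC.
move=> X Y;
  rewrite !inE !subsetD => /andP[/andP[_ dX] _] /andP[/andP[_ dY] _] /(congr1 (fun Z => Z :\: B)).
by rewrite !setDUl !setDv !set0U (setDidPl dX) (setDidPl dY).
Qed.

Section Count.
Variable G : sgraph.
Implicit Types (A B C S T X Y Z : {set G}) (x y z c p q r s h : G).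

Definition good_sets A k := [set S : {set G} | [&& S \subset A, #|S| == k & `[< good S >]]].
Definition ngood A k := #|good_sets A k|.

Lemma good_setsP A k S : reflect [/\ S \subset A, #|S| = k & good S] (S \in good_sets A k).
Proof.
rewrite inE; apply: (iffP and3P) => [[SA /eqP cS /asboolP gS]|[SA cS gS]]; split=> //.
  exact/eqP.
exact/asboolP.
Qed.

Lemma ngood_small A k : #|A| < k -> ngood A k = 0.
Proof.
move=> Ak; apply/eqP; rewrite cards_eq0; apply/eqP/setP => S; rewrite in_set0.
by apply/negP => /good_setsP[/subset_leq_card SA cS _]; nlia.
Qed.

Lemma ngood_full A : ngood A #|A| <= 1.
Proof.
rewrite -(cards1 A); apply: subset_leq_card; apply/subsetP => S /good_setsP[SA cS _].
by rewrite inE eqEcard SA cS leqnn.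
Qed.

Definition exceptional A c k := [set S in good_sets (A :\ c) k | [forall s in S, 1 < nb (c |: S)
  s]].

Lemma exceptionalP A c k S : reflect [/\ S \subset A :\ c, #|S| = k, good S &
  forall s, s \in S -> 1 < nb (c |: S) s] (S \in exceptional A c k).
Proof.
rewrite inE; apply: (iffP andP) => [[/good_setsP[SA cS gS] /forall_inP e]|[SA cS gS e]];
  split=> //.
  by apply/good_setsP.
by apply/forall_inP.
Qed.

(* A nonexceptional good set avoiding [c] is sent to the bad set in which the
   neighbour of a leaf [s] is replaced by [c], so that [s] is isolated.  The
   family [Sp] consists of further bad sets, outside the image of this map. *)
Lemma ngood_hub A c k (Sp : {set {set G}}) : c \in A -> forest (A :\ c) -> 2 < k ->
  (forall T, T \in Sp -> [/\ T \subset A, #|T| = k, c \in T, ~ good T &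
    conn T \/ forall y, y \in A -> y \notin T -> good (y |: (T :\ c)) ->
      y |: (T :\ c) \in exceptional A c k]) ->
  ngood A k + #|Sp| <= 'C(#|A|.-1, k.-1) + #|exceptional A c k|.
Proof.
move=> cA fA k2 hSp.
(* Neighbours are counted in [c |: S], so z is the only neighbour of s there, and s is not adjacent
   to c. *)
pose leafpair S (p : G * G) := [&& p.1 \in S, p.2 \in S, adj p.1 p.2 & nb (c |: S) p.1 <= 1].
pose phi S := if [pick p | leafpair S p] is Some p then c |: (S :\ p.2) else set0.
pose NE := good_sets (A :\ c) k :\: exceptional A c k.
have phiP S : S \in NE -> exists s z, [/\ [/\ S \subset A :\ c, #|S| = k & good S],
    [/\ s \in S, z \in S, s != z & adj s z], ~~ adj s c, nb (S :\ z) s = 0 & phi S = c |: (S :\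
      z)].
  rewrite inE => /andP[nE /good_setsP[SA cS gS]].
  have cnS : c \notin S by apply/negP => /(subsetP SA); rewrite !inE eqxx.
  have nb0 s : s \in S -> 0 < nb S s by move=> sS; apply: conn_nb_gt0 => //; [case: gS | nlia].
  rewrite /phi; case: pickP => [[s z] /and4P[/= sS zS sz ns]|hn].
    exists s, z; move: ns (nb0 s sS); rewrite nbU1 // (nbD1 _ zS) sz => ns _; split=> //.
    - split=> //; by apply/eqP => e; rewrite e adj_irrefl in sz.
    - by apply/negP => a; rewrite a in ns; nlia.
    - by nlia.
  case/negP: nE; apply/exceptionalP; split=> // s sS; rewrite ltnNge; apply/negP => ns.
  have /nb_gt0P[z zS sz] := nb0 s sS.
  by have := hn (s, z); rewrite /leafpair /= sS zS sz ns.
pose Un := [set T : {set G} | [&& T \subset A, #|T| == k & [set c] \subset T]].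
have cUn : #|Un| = 'C(#|A|.-1, k.-1) by rewrite card_supersets ?sub1set ?cards1 ?subn1 //; nlia.
pose gc := [set T in good_sets A k | c \in T].
have phiU S : S \in NE -> phi S \in Un /\ ~ conn (phi S).
  case/phiP=> s [z [[SA cS gS] [sS zS nsz sz] sc ns ->]].
  have cnS : c \notin S by apply/negP => /(subsetP SA); rewrite !inE eqxx.
  have cc : c \notin S :\ z by rewrite inE (negbTE cnS) andbF.
  have ck : #|c |: (S :\ z)| = k by rewrite cardsU1 cc -cS (cardsD1 z S) zS.
  split.
    rewrite inE ck eqxx sub1set setU11 andbT subUset sub1set cA andbT /=.
    by apply: subset_trans (subD1set _ _) _; apply: subset_trans SA (subD1set _ _).
  move=> cn; have : 0 < nb (c |: (S :\ z)) s.
    by apply: conn_nb_gt0; rewrite ?ck ?inE ?sS ?nsz ?orbT //; nlia.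
  by rewrite nbU1 // ns (negbTE sc).
(* The image determines X, which is S without z and has s isolated; [join_unique] says that only one
   z can reconnect X. *)
have phiI : {in NE &, injective phi}.
  move=> S S' /phiP[s [z [[SA cS gS] [sS zS nsz sz] sc ns ->]]].
  move=> /phiP[s' [z' [[SA' cS' gS'] [sS' zS' nsz' sz'] sc' ns' ->]]] e.
  have cnS : c \notin S by apply/negP => /(subsetP SA); rewrite !inE eqxx.
  have cnS' : c \notin S' by apply/negP => /(subsetP SA'); rewrite !inE eqxx.
  have eX : S :\ z = S' :\ z'.
    have := congr1 (fun Z => Z :\ c) e; rewrite !setU1K //.
      by rewrite inE (negbTE cnS') andbF.
    by rewrite inE (negbTE cnS) andbF.
  have ezz : z = z'.
    apply: (@join_unique G (A :\ c) (S :\ z) s).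
    - by [].
    - by rewrite setD1K.
    - by rewrite eX setD1K.
    - by rewrite setD1K //; case: gS.
    - by rewrite eX setD1K //; case: gS'.
    - by rewrite !inE eqxx.
    - by rewrite eX !inE eqxx.
    - by rewrite !inE nsz.
    - by [].
    - by move: k2; rewrite -cS (cardsD1 z S) zS.
  by rewrite -(setD1K zS) eX ezz setD1K.
(* An image is disconnected, which excludes the first alternative for a spare T. Under the second,
   putting z back in place of c would show that the good set S is exceptional. *)
have dSp : [disjoint phi @: NE & Sp].
  apply/pred0P => T /=; apply/negP => /andP[/imsetP[S SNE eT] TSp].
  have [_ nc] := phiU S SNE; have [_ _ _ _ []] := hSp T TSp; first by rewrite eT.
  have [s [z [[SA cS gS] [sS zS nsz sz] sc ns ephi]]] := phiP S SNE.
  have cnS : c \notin S by apply/negP => /(subsetP SA); rewrite !inE eqxx.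
  have eTc : T :\ c = S :\ z by rewrite eT ephi setU1K // inE (negbTE cnS) andbF.
  move/(_ z); rewrite eTc setD1K // => H; move: SNE; rewrite inE H //.
    by have := subsetP SA z zS; rewrite inE => /andP[].
  rewrite eT ephi !inE eqxx orbF; apply/eqP => e; by rewrite -e zS in cnS.
(* Images, spare sets and good sets through c are pairwise disjoint families of k-sets through c. *)
have big : #|phi @: NE :|: (Sp :|: gc)| <= 'C(#|A|.-1, k.-1).
  rewrite -cUn; apply: subset_leq_card; rewrite !subUset; apply/and3P; split; apply/subsetP => T.
  - by case/imsetP=> S /phiU[H _] ->.
  - by case/hSp=> TA cT cc _ _; rewrite inE TA cT eqxx sub1set.
  - by rewrite inE => /andP[/good_setsP[TA cT _] cc]; rewrite inE TA cT eqxx sub1set.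
have dgc : [disjoint phi @: NE :|: Sp & gc].
  apply/pred0P => T /=; apply/negP => /andP[+ /setIdP[/good_setsP[_ _ gT] _]].
  case/setUP=> [/imsetP[S /phiU[_ nc] eT]|/hSp[]//].
  by apply: nc; rewrite -eT; case: gT.
rewrite setUA cardsU (disjoint_setI0 dgc) cards0 subn0 cardsU (disjoint_setI0 dSp) cards0 subn0
  in big.
rewrite (card_in_imset phiI : #|phi @: NE| = #|NE|) in big.
have -> : ngood A k = #|gc| + #|good_sets (A :\ c) k|.
  rewrite /ngood -(cardsID [set T : {set G} | c \in T] (good_sets A k)); congr (_ + _).
    by apply: eq_card => T; rewrite !inE.
  apply: eq_card => T; rewrite !inE subsetD1; by case: (c \in T); rewrite ?andbF ?andbT.
rewrite -(cardsID (exceptional A c k) (good_sets (A :\ c) k)) -/NE.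
have -> : good_sets (A :\ c) k :&: exceptional A c k = exceptional A c k.
  by apply/setIidPr/subsetP => S; rewrite inE => /andP[].
by move: big; move: #|NE| #|Sp| #|gc| #|exceptional A c k| ('C(_, _)) => *; nlia.
Qed.

(** A good set either contains both ends p, q of the bridge or, being connected, stays on one side
    of it. *)
Lemma ngood_bridge A X k : X \subset A -> boundary A X = 1 -> 1 < k ->
  ngood A k <= 'C(#|A| - 2, k - 2) + ngood X k + ngood (A :\: X) k.
Proof.
move=> XA /dsum_eq1[p [q [pX qD pq uniq]]] k1.
have [qX qA] : q \notin X /\ q \in A by move: qD; rewrite inE => /andP[].
have npq : p != q by apply/eqP => e; rewrite -e pX in qX.
have c2 : #|[set p; q]| = 2 by rewrite cards2 npq.
have pqA : [set p; q] \subset A by rewrite subUset !sub1set qA (subsetP XA).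
rewrite -{1}c2 -{1}c2 -card_supersets ?c2 //.
apply: leq_trans (leq_trans _ (leq_add (leq_card_setU _ _) (leqnn _))); last exact: leq_card_setU.
apply: subset_leq_card; apply/subsetP => S /good_setsP[SA cS gS].
have [pqS|npqS] := boolP ([set p; q] \subset S); first by rewrite !in_setU inE SA cS eqxx pqS.
have noedge x y : x \in X -> y \in A -> y \notin X -> x \in S -> y \in S -> adj x y -> False.
  move=> xX yA yX xS yS xy; have [|||ex ey] := uniq x y => //; first by rewrite inE yX.
  by case/negP: npqS; rewrite subUset !sub1set -ex -ey xS.
have [x0 x0S] : exists x, x \in S by apply/set0Pn; case: gS => -[].
have [[_ cn] _] := gS; have [x0X|x0X] := boolP (x0 \in X).
  suff SX : S \subset X by rewrite !in_setU (introT (good_setsP X k S)) ?orbT.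
  apply: (cn _ x0) => // x y xX xS yS xy; apply/negPn/negP => yX.
  by apply: (noedge x y) => //; apply: (subsetP SA).
suff SD : S \subset A :\: X by rewrite !in_setU (introT (good_setsP (A :\: X) k S)) ?orbT.
apply: (cn _ x0) => //; first by rewrite inE x0X (subsetP SA).
move=> x y; rewrite !inE => /andP[xX xA] xS yS xy; rewrite (subsetP SA) // andbT.
apply/negP => yX; apply: (noedge y x) => //; by rewrite adj_sym.
Qed.

End Count.

(** * The game *)

Section Game.
Variable G : sgraph.
Implicit Types (C S X : {set G}).

(** If some X splits S with no edge across, the robber waits forever on the side that the cop did
    not choose. *)
Lemma cop_win_conn S : cop_win (induced S) -> conn S.
Proof.
move=> [sigma leg win]; split; first by apply/set0Pn; exists (val (sigma [::])); apply: valP.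
move=> X x0 x0X x0S clX; apply: contrapT => /negP/subsetPn[y0 y0S y0X].
pose inX (u : induced S) := val u \in X.
have side (u v : induced S) : legal_move u v -> inX u = inX v.
  rewrite /legal_move /inX => /orP[/eqP->//|uv]; apply/idP/idP => H.
    exact: clX H (valP u) (valP v) uv.
  by apply: clX H (valP v) (valP u) _; rewrite adj_sym.
pose r0 : induced S := if inX (sigma [::]) then Sub y0 y0S else Sub x0 x0S.
have r0X : inX r0 = ~~ inX (sigma [::]).
  by rewrite /r0; case: ifP => _; rewrite /inX SubK ?x0X // (negbTE y0X).
have rp : robber_play (fun _ : nat => r0) by move=> n; rewrite /legal_move eqxx.
have inv n : inX (cop_pos sigma (fun=> r0) n) = inX (sigma [::]).
  by elim: n => // n IH; rewrite -IH; apply/esym/side/leg.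
have [n [e|e]] := win _ rp.
  by have := inv n; rewrite e r0X; case: (inX _).
by have := inv n.+1; rewrite e r0X; case: (inX _).
Qed.

Lemma cop_win_not_evasive S C : cop_win (induced S) -> ~ evasive C S.
Proof.
move=> [sigma leg win] [CS start esc].
pose safe (c r' : induced S) := [&& val r' \in C, r' != c & ~~ adj (val c) (val r')].
(* The robber's answer to its own past [h], when the cop has just moved to [sigma h]. The default,
   staying put, makes the play legal before safety is known. *)
pose step (h : seq (induced S)) : induced S :=
  if h is x :: h' then
    let r := last x h' in odflt r [pick r' | legal_move r r' && safe (sigma h) r']
  else odflt (sigma [::]) [pick r' | safe (sigma [::]) r'].
pose hist := fix hist n := if n is m.+1 then rcons (hist m) (step (hist m)) else [::].
pose r n := step (hist n).
have histE n : mkseq r n = hist n.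
  by elim: n => // n IH; rewrite mkseqS IH.
have rS n : r n.+1 = odflt (r n) [pick r' | legal_move (r n) r' && safe (cop_pos sigma r n.+1)
  r'].
  rewrite /cop_pos histE {1}/r /=; case E : (rcons _ _) => [|x h']; first by case: (hist n) E.
  suff -> : r n = last x h' by [].
  by rewrite -(last_rcons x (hist n) (r n)) E.
have rp : robber_play r.
  move=> n; rewrite rS; case: pickP => [r' /andP[]//|_] /=; by rewrite /legal_move eqxx.
have inv n : safe (cop_pos sigma r n) (r n).
  elim: n => [|n IH].
    rewrite /r /=; case: pickP => //= hn.
    have [x xC /andP[ne na]] := start _ (valP (sigma [::])).
    have := hn (Sub x (subsetP CS x xC)); rewrite /safe SubK xC na andbT /= => /negbT.
    by rewrite negbK => /eqP e; rewrite -e SubK eqxx in ne.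
  rewrite rS; case: pickP => [r' /andP[]//|hn] /=.
  have [/[dup]rC _ /[swap]/[swap]] := and3P IH; rewrite eq_sym => ne na.
  have ne' : val (cop_pos sigma r n.+1) != val (r n).
    rewrite (inj_eq val_inj); apply/eqP => e; have := leg r rp n.
    by rewrite e /legal_move (negbTE ne) /= => a; case/negP: na.
  have [x xC /and3P[mv ne1 na1]] := esc _ _ rC (valP (cop_pos sigma r n.+1)) ne'.
  have := hn (Sub x (subsetP CS x xC)); rewrite /safe SubK xC na1 andbT /=.
  rewrite -(inj_eq val_inj) SubK ne1 andbT /legal_move -(inj_eq val_inj) SubK.
  by rewrite mv.
have [n [e|e]] := win r rp; have /and3P[_ ne na] := inv n.
  by rewrite e eqxx in ne.
by have := leg r rp n; rewrite /legal_move e eq_sym (negbTE ne) /= => a; case/negP: na.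
Qed.

Lemma cop_win_good S : cop_win (induced S) -> good S.
Proof. by move=> cw; split; [exact: cop_win_conn | move=> C; exact: cop_win_not_evasive]. Qed.

(* The cop starts at [d] and then always moves to the last robber position. *)
Lemma cop_win_dominated S d : d \in S -> (forall x, x \in S -> x != d -> adj d x) ->
  cop_win (induced S).
Proof.
move=> dS dom; exists (last (Sub d dS : induced S)) => [r rp [|n]|r rp].
- rewrite /cop_pos /= /legal_move; case: eqVneq => //= ne; apply: dom; first exact: valP.
  by rewrite -(inj_eq val_inj) /= eq_sym in ne.
- by rewrite /cop_pos !mkseqS !last_rcons; apply: rp.
by exists 0; right.
Qed.

End Game.

(** * A vertex of degree four, and sides of a bridge *)

Section Leafless.
Variable G : sgraph.
Implicit Types (A B C S T X Y Z : {set G}) (x y z c p q r s h : G).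

Lemma dsum_ge m X B : (forall x, x \in X -> m <= nb B x) -> #|X| * m <= dsum X B.
Proof. by move=> h; rewrite -sum_nat_const; apply: leq_sum. Qed.

Lemma dsum_le m X B : (forall x, x \in X -> nb B x <= m) -> dsum X B <= #|X| * m.
Proof. by move=> h; rewrite -sum_nat_const; apply: leq_sum. Qed.

Lemma boundary_eq0 A X : conn A -> X \subset A -> X != set0 -> boundary A X = 0 -> X = A.
Proof.
move=> cA XA /set0Pn[x xX] b0; apply/eqP; rewrite eqEsubset XA; apply/subsetP => y yA.
by apply/negPn/negP => yX; have := conn_boundary cA XA xX yA yX; rewrite b0.
Qed.

Lemma nb_le A c : nb A c <= #|A|.
Proof. by apply: subset_leq_card; apply/subsetP => x; rewrite inE => /andP[]. Qed.

Lemma nb_lt A c : c \in A -> nb A c < #|A|.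
Proof. by move=> cA; rewrite -nb_self [leqRHS](cardsD1 c) cA ltnS nb_le. Qed.

Lemma dsum_hub S c : c \notin S -> dsum S (c |: S) = vol S + nb S c.
Proof.
move=> cS; rewrite addnC nbE /vol /dsum -big_split; apply: eq_bigr => s _ /=.
by rewrite nbU1 // adj_sym.
Qed.

(** The degrees into [c |: S] sum to at least 2|S|, but the forest S supplies at most 2|S| - 2. *)
Lemma exceptional_nb S c : forest S -> S != set0 -> c \notin S ->
  (forall s, s \in S -> 1 < nb (c |: S) s) -> 1 < nb S c.
Proof. by move=> fS S0 cS /dsum_ge; rewrite dsum_hub //; have := vol_forest fS S0; nlia. Qed.

Lemma exceptional_closed A S c : c \in A -> S \subset A -> (forall s, s \in S -> nb A s = 2) ->
  (forall s, s \in S -> 1 < nb (c |: S) s) ->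
  forall s y, s \in S -> y \in A -> adj s y -> y \in c |: S.
Proof.
move=> cA SA d2 e s y sS yA sy; apply/negPn/negP => yZ.
have ZA : c |: S \subset A by rewrite subUset sub1set cA.
have := d2 s sS; rewrite (nb_split s ZA); have := e s sS.
suff : 0 < nb (A :\: (c |: S)) s by nlia.
by apply/nb_gt0P; exists y; rewrite // inE yZ.
Qed.

(** Vertices of an exceptional set have both their neighbours in [c |: S], so the set is a component
    of A without c. *)
Lemma exceptional_disjoint A S S' c : c \in A -> S \subset A :\ c -> S' \subset A :\ c ->
  (forall s, s \in A -> s != c -> nb A s = 2) -> conn S -> conn S' -> #|S| = #|S'| ->
  (forall s, s \in S -> 1 < nb (c |: S) s) ->
  (forall s, s \in S' -> 1 < nb (c |: S') s) -> S = S' \/ [disjoint S & S'].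
Proof.
move=> cA SA SA' d2 [_ cS] [_ cS'] eq e e'.
have dS X : X \subset A :\ c -> forall s, s \in X -> nb A s = 2.
  by move=> XA s /(subsetP XA); rewrite !inE => /andP[sc sA]; apply: d2.
have SsA X : X \subset A :\ c -> X \subset A by move=> XA; apply: subset_trans XA (subD1set _ _).
have [dis|/pred0Pn[x /andP[/= xS xS']]] := boolP [disjoint S & S']; first by right.
left; apply/eqP; rewrite eqEcard eq leqnn andbT; apply: (cS S' x) => // u v uS' uS vS uv.
have vA : v \in A by apply: subsetP (SsA S SA) v vS.
have := exceptional_closed cA (SsA _ SA') (dS _ SA') e' uS' vA uv.
case/setU1P=> // vc; by have := subsetP SA v vS; rewrite !inE vc eqxx.
Qed.

(** A core avoiding c uses up all the degrees of its vertices, so no edge leaves it; by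
    connectedness it is A, which contains c. *)
Lemma forest_D1 A X c : conn A -> X \subset A -> c \in X ->
  (forall x, x \in X -> x != c -> nb A x <= 2) -> forest (X :\ c).
Proof.
move=> cA XA cX d2 Y YX Y0; apply: contrapT => hn.
have YA : Y \subset A by apply: subset_trans YX (subset_trans (subD1set _ _) XA).
have n2 y : y \in Y -> 1 < nb Y y.
  by move=> yY; rewrite ltnNge; apply/negP => ny; apply: hn; exists y.
have le2 : dsum Y A <= #|Y| * 2.
  by apply: dsum_le => y /(subsetP YX); rewrite !inE => /andP[? ?]; apply: d2.
have := dsum_boundary YA; have := dsum_ge n2; rewrite -/(vol Y) => H1 H2.
have := subsetP YX c; rewrite (boundary_eq0 cA YA Y0) ?(subsetP XA) ?inE ?eqxx //; last by nlia.
by move=> /(_ isT).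
Qed.

Definition bicyclic_set A := conn A /\ vol A = #|A|.*2.+2.

(* An exceptional set [S] is a cycle through [c] without [c]; the spare set is
   obtained by trading the two neighbours of [c] in [S] for [c] and a vertex
   outside the cycle. *)
Lemma ngood_deg4 A c k : bicyclic_set A -> c \in A -> nb A c = 4 ->
  (forall x, x \in A -> x != c -> nb A x = 2) -> 3 < k -> ngood A k <= 'C(#|A|.-1, k.-1).
Proof.
move=> [cA _] cinA nc d2 k3.
have fA : forest (A :\ c) by apply: forest_D1 cA _ _ _ => // x xA xc; rewrite d2.
(* The default never occurs: c has four neighbours in A and only two in S. *)
pose other S := odflt c [pick h in A :\: (c |: S)].
pose T S := c |: (other S |: (S :\: [set y in S | adj c y])).
have facts S : S \in exceptional A c k -> [/\ [/\ S \subset A :\ c, #|S| = k & conn S],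
    [/\ S \subset A, c \notin S, forall s, s \in S -> 1 < nb (c |: S) s & nb S c = 2],
    [/\ other S \in A, other S != c & other S \notin S] &
    forall s y, s \in S -> y \in A -> adj s y -> y \in c |: S].
  case/exceptionalP=> SA cS [cnS _] e.
  have SA' : S \subset A by apply: subset_trans SA (subD1set _ _).
  have cnotS : c \notin S by apply/negP => /(subsetP SA); rewrite !inE eqxx.
  have d2S s : s \in S -> nb A s = 2.
    by move=> /(subsetP SA); rewrite !inE => /andP[? ?]; apply: d2.
  have S0 : S != set0 by case: cnS.
  have cl := exceptional_closed cinA SA' d2S e.
  have nS : nb S c = 2.
    have := exceptional_nb (forestS SA fA) S0 cnotS e; have := vol_conn cnS.
    have : dsum S (c |: S) <= #|S| * 2.
      by apply: dsum_le => s sS; rewrite -(d2S s sS); apply: nbS; rewrite subUset sub1set cinA.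
    by rewrite dsum_hub //; nlia.
  split=> //; rewrite /other; case: pickP => [h|hn] /=.
    by rewrite !inE negb_or => /andP[/andP[-> ->] ->].
  suff eA : A = c |: S by move: nc; rewrite eA nbU1 // adj_irrefl nS.
  apply/eqP; rewrite eqEsubset subUset sub1set cinA SA' !andbT; apply/subsetP => y yA.
  by apply/negPn/negP => yZ; have := hn y; rewrite inE yZ yA.
have cR S : #|S| = k -> nb S c = 2 -> #|S :\: [set y in S | adj c y]| = k - 2.
  move=> cS n2; rewrite cardsD (setIidPr _); last by apply/subsetP => x; rewrite inE => /andP[].
  by rewrite cS -/(nb S c) n2.
have TI : {in exceptional A c k &, injective T}.
  move=> S S' /facts[[SA cS cnS] [_ cnotS e n2] [oA oc oS] _].
  move=> /facts[[SA' cS' cnS'] [_ cnotS' e' _] [oA' oc' oS'] _] eT.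
  have eqc : #|S| = #|S'| by rewrite cS cS'.
  have [//|dis] := exceptional_disjoint cinA SA SA' d2 cnS cnS' eqc e e'.
  (* With S and S' disjoint, equal spare sets would squeeze the k - 2 >= 2 remaining vertices of S
     into one. *)
  have : S :\: [set y in S | adj c y] \subset [set other S'].
    apply/subsetP => x xR; have xS : x \in S by move: xR; rewrite inE => /andP[].
    have : x \in T S' by rewrite -eT !in_setU xR !orbT.
    rewrite !inE; case/or3P=> [/eqP ex|->//|/andP[_ xS']]; first by rewrite -ex xS in cnotS.
    by have /pred0P/(_ x) := dis; rewrite /= xS xS'.
  by move/subset_leq_card; rewrite cards1 cR //; nlia.
have := @ngood_hub G A c k (T @: exceptional A c k) cinA fA (ltnW k3).
rewrite (card_in_imset TI) leq_add2r;
  apply=> _ /imsetP[S /facts[[SA cS cnS] [SA' cnotS e n2] [oA oc oS] cl] ->].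
pose R := S :\: [set y in S | adj c y]; rewrite -[T S]/(c |: (other S |: R)).
have {}cR : #|R| = k - 2 by apply: cR.
have RS : R \subset S by apply: subsetDl.
have oR : other S \notin R by apply/negP => /(subsetP RS); rewrite (negbTE oS).
have cTS : c \notin other S |: R.
  by rewrite in_setU1 eq_sym (negbTE oc); apply: contra cnotS; apply: (subsetP RS).
split.
- by rewrite !subUset !sub1set cinA oA (subset_trans RS SA').
- by rewrite !cardsU1 cTS oR cR; nlia.
- by rewrite setU11.
- case=> -[_ cn] _; have /card_gt0P[x xR] : 0 < #|R| by rewrite cR; nlia.
  suff /subsetP/(_ c (setU11 _ _))/(subsetP RS) : c |: (other S |: R) \subset R.
    by rewrite (negbTE cnotS).
  apply: (cn R x) => //; first by rewrite !in_setU xR !orbT.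
  move=> u v uR _; have uS := subsetP RS u uR; rewrite !in_setU !in_set1.
  case/or3P=> // /eqP-> uv; last by have := cl u _ uS oA uv; rewrite !inE (negbTE oc) (negbTE oS).
  by move: uR; rewrite !inE uS andbT adj_sym uv.
(* With c gone, nothing outside S is adjacent to S, so [other S] cannot be reached from it, whatever
   y is. *)
right=> y yA yT [[_ cn] _]; exfalso; move: cn; rewrite setU1K // => cn.
have /card_gt0P[x xR] : 0 < #|R| by rewrite cR; nlia.
suff : y |: (other S |: R) \subset S by rewrite !subUset !sub1set (negbTE oS) andbF.
apply: (cn S x); rewrite ?(subsetP RS) // ?in_setU ?xR ?orbT // => u v uS _ vU uv.
have vA : v \in A.
  by move: vU; rewrite !in_setU !in_set1 => /or3P[/eqP->|/eqP->|/(subsetP RS)/(subsetP SA')].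
have /setU1P[ec|//] := cl u v uS vA uv; move: vU;
  rewrite ec in_setU1 (negbTE cTS) orbF => /eqP cy.
by move: yT; rewrite -cy setU11.
Qed.

(** At most one set is exceptional: two distinct ones would be disjoint, each with two neighbours of
    c, which has only three. Such a set avoids c, hence the correction only for k < |X|. *)
Lemma ngood_side A X c k : conn A -> X \subset A -> c \in X -> nb A c = 3 ->
  (forall x, x \in X -> x != c -> nb A x = 2) -> 2 < k -> boundary A X = 1 ->
  2 < #|X| /\ ngood X k <= 'C(#|X|.-1, k.-1) + (k < #|X|).
Proof.
move=> cA XA cX nc d2 k2 b1.
have nXc : 1 < nb X c.
  have := nb_split c XA; have := b1; rewrite /boundary /dsum (big_setD1 c cX) /= nc; nlia.
split; first by apply: leq_ltn_trans nXc (nb_lt cX).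
have fX : forest (X :\ c) by apply: forest_D1 cA XA cX _ => x xX xc; rewrite d2.
have := @ngood_hub G X c k set0 cX fX k2; rewrite cards0 addn0 => /(_ _)/leq_trans; apply.
  by move=> T; rewrite inE.
rewrite leq_add2l.
have [e0|/set0Pn[S SE]] := eqVneq (exceptional X c k) set0; first by rewrite e0 cards0.
have /exceptionalP[SX cS gS eS] := SE; have := subset_leq_card SX.
rewrite cS => kX; have -> : k < #|X| by rewrite (cardsD1 c X) cX.
apply: (@leq_trans #|[set S]|); last by rewrite cards1.
apply: subset_leq_card; apply/subsetP => S' /exceptionalP[SX' cS' gS' eS']; rewrite inE.
have sub Y : Y \subset X :\ c -> Y \subset A :\ c by move=> YX;
  apply: subset_trans YX (setSD _ XA).
have cnot Y : Y \subset X :\ c -> c \notin Y.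
  by move=> YX; apply/negP => /(subsetP YX); rewrite !inE eqxx.
have nbc Y : Y \subset X :\ c -> good Y -> (forall s, s \in Y -> 1 < nb (c |: Y) s) -> 1 < nb Y c.
  by move=> YX [[Y0 _] _] eY; apply: exceptional_nb eY => //;
    [apply: forestS YX fX | apply: cnot].
have clos Y : Y \subset X :\ c -> (forall s, s \in Y -> 1 < nb (c |: Y) s) ->
    forall s y, s \in Y -> y \in A -> adj s y -> y \in c |: Y.
  move=> YX; apply: exceptional_closed; first exact: (subsetP XA).
    by apply: subset_trans (sub _ YX) (subD1set _ _).
  by move=> s /(subsetP YX); rewrite !inE => /andP[? ?]; apply: d2.
have [dis|/pred0Pn[x /andP[/= xS xS']]] := boolP [disjoint S & S'].
  have UA : S :|: S' \subset A.
    by rewrite subUset !(subset_trans (sub _ _) (subD1set A c)).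
  have := nbS c UA; rewrite nc (nb_split c (subsetUl S S')) setDUl setDv set0U.
  rewrite (setDidPl _) 1?disjoint_sym //; have := nbc S SX gS eS; have := nbc S' SX' gS' eS';
    nlia.
rewrite eq_sym eqEcard cS cS' leqnn andbT; apply: (gS.1.2 S' x) => // u v uS' uS vS uv.
have vA : v \in A by have := subsetP (sub _ SX) v vS; rewrite inE => /andP[].
have /setU1P[vc|//] := clos S' SX' eS' u v uS' vA uv; by have := cnot S SX; rewrite -vc vS.
Qed.

End Leafless.

(** * Two branching vertices, no bridge *)

Section Theta.
Variables (G : sgraph) (A : {set G}) (P Q : G).
Hypotheses (bA : bicyclic_set A) (PA : P \in A) (QA : Q \in A) (PQ : P != Q).
Hypotheses (nP : nb A P = 3) (nQ : nb A Q = 3).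
Hypothesis d2 : forall x, x \in A -> x != P -> x != Q -> nb A x = 2.
Hypothesis bridgeless : forall X : {set G}, X \subset A -> X != set0 -> X != A -> 1 < boundary A
  X.
Implicit Types (S T X Y Z : {set G}) (x y z p q r s h : G).

Let cA : conn A := bA.1.
Let vA : vol A = #|A|.*2.+2 := bA.2.

Lemma dsum_theta X : X \subset A -> dsum X A = #|X|.*2 + (P \in X) + (Q \in X).
Proof.
move=> XA; have ind p : (p \in X : nat) = \sum_(x in X) (x == p).
  have [pX|pX] := boolP (p \in X).
    by rewrite (big_setD1 p pX) /= eqxx big1 // => x; rewrite !inE => /andP[/negbTE->].
  by rewrite big1 // => x xX; case: eqP => // e; rewrite -e xX in pX.
rewrite (ind P) (ind Q) -muln2 -sum_nat_const /dsum -!big_split; apply: eq_bigr => x xX /=.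
have [->|xP] := eqVneq x P; first by rewrite nP (negbTE PQ).
have [->|xQ] := eqVneq x Q; first by rewrite nQ.
by rewrite d2 // (subsetP XA).
Qed.

(** The degree sum over X exceeds 2|X| by at most two. At least 2|X| is spent inside a core and at
    least two edges leave it, so all is tight: X is a cycle through P and Q. *)
Lemma core_theta X : X \subset A -> X != set0 -> X != A -> (forall x, x \in X -> 1 < nb X x) ->
  [/\ P \in X, Q \in X, boundary A X = 2 & forall x, x \in X -> nb X x = 2].
Proof.
move=> XA X0 XnA n2; have := dsum_theta XA; rewrite (dsum_boundary XA).
have := bridgeless XA X0 XnA; have := dsum_ge n2; rewrite -/(vol X) => v2 b2 e.
have [PX QX v bX] : [/\ P \in X, Q \in X, vol X = #|X|.*2 & boundary A X = 2].
  by move: e; case: (P \in X); case: (Q \in X) => /= e; split=> //; nlia.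
split=> // x xX; apply/eqP; rewrite eqn_leq n2 // andbT leqNgt; apply/negP => nx.
have : #|X :\ x| * 2 <= dsum (X :\ x) X by apply: dsum_ge => y; rewrite inE => /andP[_ /n2].
move: v; rewrite /vol {1}/dsum (big_setD1 x xX) /= -/(dsum _ _) (cardsD1 x X) xX; nlia.
Qed.

Lemma core_card X : X \subset A -> X != set0 -> X != A -> (forall x, x \in X -> 1 < nb X x) ->
  2 < #|X|.
Proof. by move=> XA X0 XnA n2; have [PX _ _ e] := core_theta XA X0 XnA n2;
  rewrite -(e P PX) nb_lt. Qed.

(* The complement of a core in a larger core is a core again, so it would
   contain [P] as well. *)
Lemma core_uniq X Y : X \subset A -> X != A -> (forall x, x \in X -> 1 < nb X x) ->
  Y \subset X -> Y != set0 -> (forall y, y \in Y -> 1 < nb Y y) -> Y = X.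
Proof.
move=> XA XnA nX YX Y0 nY; apply/eqP; rewrite eqEsubset YX -setD_eq0 /=; apply/negPn/negP => D0.
have YA := subset_trans YX XA.
have X0 : X != set0 by apply: contraNneq Y0 => X0; rewrite -subset0 -X0.
have YnA : Y != A.
  by apply: contraNneq XnA => YA'; rewrite eqEsubset XA -YA' YX.
have [_ _ _ nX2] := core_theta XA X0 XnA nX; have [PY _ _ nY2] := core_theta YA Y0 YnA nY.
have dYD y x : y \in Y -> x \in X :\: Y -> adj y x -> False.
  move=> yY xD yx; have := nX2 y (subsetP YX y yY); rewrite (nb_split y YX) nY2 //.
  by move/eqP; rewrite -{2}[2]addn0 eqn_add2l => /nb0P/(_ x xD)/negP.
have [||||PD _ _ _] := @core_theta (X :\: Y) => //.
- exact: subset_trans (subsetDl _ _) XA.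
- by apply: contraNneq XnA => e; rewrite eqEsubset XA -e subsetDl.
- move=> x xD; have xX : x \in X by move: xD; rewrite inE => /andP[].
  have := nX x xX; rewrite (nb_split x YX); suff /eqP-> : nb Y x == 0 by [].
  by apply/nb0P => y yY; apply/negP; rewrite adj_sym; apply: dYD.
by move: PD; rewrite inE PY.
Qed.

(** Every vertex has at most two neighbours in X. Hence a cop cannot dominate four vertices at the
    start, and a cop off X cannot cover the robber and both its neighbours. A cop on X could only
    trap the robber in a triangle, which by [core_uniq] would be all of X. *)
Lemma core_evasive X T : X \subset T -> T \subset A -> X != A ->
  (forall x, x \in X -> 1 < nb X x) -> 3 < #|X| -> evasive X T.
Proof.
move=> XT TA XnA nX X3; have XA := subset_trans XT TA.
have X0 : X != set0 by rewrite -card_gt0; nlia.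
have [PX QX bX nX2] := core_theta XA X0 XnA nX.
have nout c : c \in A -> c \notin X -> nb X c <= 2.
  move=> cA' cX; rewrite -bX /boundary dsumC /dsum (bigD1 c) /= ?leq_addr //.
  by rewrite inE cX.
have nle c : c \in A -> nb X c <= 2.
  by move=> cA'; have [/nX2->|] := boolP (c \in X); last exact: nout.
pose N c := [set y in X | adj c y].
have NX c : N c \subset X by apply/subsetP => y; rewrite inE => /andP[].
split=> // [c cT|r c rX cT cr]; apply: contrapT => hn.
  have : #|X| <= #|c |: N c|.
    apply: subset_leq_card; apply/subsetP => r rX; rewrite !inE rX /=.
    apply/negPn/negP; rewrite negb_or => h; by apply: hn; exists r.
  have := nle c (subsetP TA c cT); rewrite cardsU1 -/(#|N c|) /nb -/(N c);
    case: (c \notin _) => /=; nlia.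
have H r' : r' \in X -> (r == r') || adj r r' -> r' != c -> adj c r'.
  by move=> r'X rr' ne; apply/negPn/negP => na; apply: hn; exists r'; rewrite // rr' ne.
have acr : adj c r by apply: H => //; rewrite ?eqxx // eq_sym.
have cN : #|N r| = 2 by exact: nX2.
have rN : r \notin N r by rewrite inE adj_irrefl andbF.
have [cX|cX] := boolP (c \in X); last first.
  have := nout c (subsetP TA c cT) cX; suff : #|r |: N r| <= nb X c by rewrite cardsU1 rN cN;
    nlia.
  apply: subset_leq_card; apply/subsetP => x /setU1P[->|]; rewrite !inE ?rX //.
  move=> /andP[xX rx]; rewrite xX H ?rx ?orbT //; by apply: contraNneq cX => <-.
have cNr : c \in N r by rewrite inE cX adj_sym.
have /card_gt0P[d] : 0 < #|N r :\ c| by move: cN; rewrite (cardsD1 c) cNr; nlia.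
rewrite !inE => /and3P[dc dX rd].
have cd : adj c d by apply: H => //; rewrite rd orbT.
have YX : [set r; c; d] \subset X by rewrite !subUset !sub1set rX cX dX.
have rd' : r != d by apply/eqP => e; rewrite e adj_irrefl in rd.
have Y3 : #|[set r; c;
  d]| = 3 by rewrite setUC cardsU1 cards2 !inE !negb_or eq_sym rd' dc eq_sym cr.
suff YeX : [set r; c; d] = X by rewrite -YeX Y3 in X3.
have two y u v : u \in [set r; c; d] -> v \in [set r; c; d] -> u != v -> adj y u -> adj y v ->
    1 < nb [set r; c; d] y.
  move=> uY vY uv yu yv; rewrite (nbD1 _ uY) yu ltnS; apply/nb_gt0P; exists v => //.
  by rewrite inE vY inE eq_sym uv.
apply: core_uniq => //; first by apply/set0Pn; exists r; rewrite !inE eqxx.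
move=> y; rewrite !inE -orbA => /or3P[]/eqP->.
- by apply: (two _ c d); rewrite ?inE ?eqxx ?orbT // 1?eq_sym // adj_sym.
- by apply: (two _ r d); rewrite ?inE ?eqxx ?orbT // 1?eq_sym // adj_sym.
- by apply: (two _ r c); rewrite ?inE ?eqxx ?orbT // 1?eq_sym // adj_sym.
Qed.

Lemma forest_theta : forest (A :\ P).
Proof.
move=> Y YA Y0; apply: contrapT => hn.
have n2 y : y \in Y -> 1 < nb Y y.
  by move=> yY; rewrite ltnNge; apply/negP => ny; apply: hn; exists y.
have PY : P \notin Y by apply/negP => /(subsetP YA); rewrite !inE eqxx.
have YnA : Y != A by apply: contraNneq PY => ->.
by have [] := core_theta (subset_trans YA (subD1set A P)) Y0 YnA n2; rewrite (negbTE PY).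
Qed.

Lemma triangle_core X : #|X| = 3 -> P \in X -> Q \in X ->
  exists v, [/\ X = [set P; Q; v], v != P & v != Q].
Proof.
move=> X3 PX QX; have : #|X :\ P :\ Q| == 1.
  by move: X3; rewrite (cardsD1 P) PX (cardsD1 Q) !inE eq_sym PQ QX; nlia.
case/cards1P=> v ev; exists v; have : v \in X :\ P :\ Q by rewrite ev set11.
rewrite !inE => /and3P[vQ vP vX]; split=> //.
have QX' : Q \in X :\ P by rewrite !inE eq_sym PQ.
by rewrite -{1}(setD1K PX) -{1}(setD1K QX') ev setUA.
Qed.

(** Deleting a vertex y of degree 2 leaves as many edges as vertices, hence a core; with four
    vertices or more it is evasive. Otherwise it is a triangle P, Q, v, and v is deleted instead. A
    second triangle P, Q, w would exhaust all degrees and force |A| = 4. *)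
Lemma bad_D1 : 4 < #|A| -> exists y, [/\ y \in A, y != P & ~ good (A :\ y)].
Proof.
move=> A4.
have core y : y \in A -> y != P -> y != Q -> ~ good (A :\ y) \/
    exists v, [/\ v \in A, v != y, v != P & v != Q] /\ forall x, x \in [set P; Q;
      v] -> 1 < nb [set P; Q; v] x.
  move=> yA yP yQ; have := d2 yA yP yQ; have := vA; rewrite (volD1 yA) (cardsD1 y A) yA => vy ny.
  have Ay : A :\ y != set0 by rewrite -card_gt0; move: A4; rewrite (cardsD1 y A) yA; nlia.
  have [|X [XA X0 nX]] := has_core Ay; first by nlia.
  have yX : y \notin X by apply/negP => /(subsetP XA); rewrite !inE eqxx.
  have XnA : X != A by apply: contraNneq yX => ->.
  have XA' := subset_trans XA (subD1set A y).
  have [X4|X3] := ltnP 3 #|X|.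
    by left=> -[_ ne]; apply: (ne X); apply: core_evasive; rewrite ?subD1set.
  right; have [PX QX _ _] := core_theta XA' X0 XnA nX.
  have [|//|//|v [eX vP vQ]] := @triangle_core X.
    by apply/eqP; rewrite eqn_leq X3 core_card.
  have vX : v \in X by rewrite eX !inE eqxx orbT.
  exists v; rewrite -eX; split=> //; split=> //; first exact: (subsetP XA').
  by apply: contraNneq yX => <-.
have /card_gt0P[y] : 0 < #|A :\ P :\ Q|.
  by move: A4; rewrite (cardsD1 P A) PA (cardsD1 Q (A :\ P)) !inE eq_sym PQ QA; nlia.
rewrite !inE => /and3P[yQ yP yA]; have [|[v [[vA' vy vP vQ] nX]]] := core y yA yP yQ;
  first by exists y.
have [|[w [[wA wv wP wQ] nX']]] := core v vA' vP vQ; first by exists v.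
pose X := [set P; Q; v]; pose U := w |: X.
have XA : X \subset A by rewrite !subUset !sub1set PA QA vA'.
have wX : w \notin X by rewrite !inE !negb_or wP wQ wv.
have nw : 1 < nb X w.
  have := nX' w; rewrite !inE eqxx orbT => /(_ isT); rewrite setUC nbU1 ?inE ?negb_or ?wP //.
  by rewrite adj_irrefl add0n => /leq_trans; apply; apply: nbS; apply: subsetUl.
have UA : U \subset A by rewrite subUset sub1set wA.
have X3 : #|X| <= 3 by rewrite /X setUC cardsU1 cards2; case: (_ \notin _); case: (_ != _).
have U4 : #|U| <= 4 by rewrite cardsU1; case: (_ \notin _); nlia.
suff e : U = A by rewrite -e in A4; nlia.
apply: (boundary_eq0 cA UA); first by apply/set0Pn; exists w; rewrite setU11.
have X0 : X != set0 by apply/set0Pn; exists P; rewrite !inE eqxx.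
have := dsum_theta UA; rewrite dsum_boundary // volU1 // cardsU1 wX.
have := dsum_ge nX; rewrite -/X -/(vol X); case: (P \in U); case: (Q \in U) => /=; nlia.
Qed.

(* The only exceptional set is [A :\ P]; the spare set is [A] without a vertex
   chosen so that a cycle of length at least 4 remains. *)
Lemma ngood_theta_minus1 k : 3 < k -> k.+1 = #|A| -> ngood A k <= 'C(#|A|.-1, k.-1).
Proof.
move=> k3 kA; have [|y [yA yP ng]] := bad_D1; first by nlia.
have [e0|/set0Pn[S SE]] := eqVneq (exceptional A P k) set0.
  have := @ngood_hub G A P k set0 PA forest_theta (ltnW k3).
  by rewrite e0 !cards0 !addn0; apply=> T; rewrite inE.
have cAP : #|A :\ P| = k by move: kA; rewrite (cardsD1 P A) PA; nlia.
have full S' : S' \in exceptional A P k -> S' = A :\ P.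
  by case/exceptionalP=> SA cS _ _; apply/eqP; rewrite eqEcard SA cS cAP leqnn.
have := @ngood_hub G A P k [set A :\ y] PA forest_theta (ltnW k3).
rewrite cards1 => H; have e1 : #|exceptional A P k| <= 1.
  by rewrite -(cards1 (A :\ P)); apply: subset_leq_card; apply/subsetP => S' /full->; rewrite inE.
suff : ngood A k + 1 <= 'C(#|A|.-1, k.-1) + #|exceptional A P k| by nlia.
apply: H => T; rewrite inE => /eqP->; split=> //.
- exact: subD1set.
- by move: kA; rewrite (cardsD1 y A) yA; nlia.
- by rewrite !inE eq_sym yP.
right=> z zA; rewrite in_setD1 zA andbT negbK => /eqP-> _.
rewrite (_ : y |: _ = S) // (full S SE).
by apply/setP => x; rewrite !inE; case: (eqVneq x y) => [->|] //=; rewrite ?yP ?yA ?andbT.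
Qed.

(** The degree sum over [P |: S] is at most 2k + 4. Connectedness of S takes 2k - 2, the edges from
    P to S take 4, and bridgelessness 2. Equality makes [P |: S] a cycle through Q, left by one edge
    at P and one at Q. *)
Lemma exceptional_theta S k : k.+1 < #|A| -> S \in exceptional A P k ->
  [/\ [/\ S \subset A, P \notin S, #|S| = k & conn S],
      [/\ Q \in S, nb S P = 2, nb (A :\: (P |: S)) P = 1 & vol (P |: S) = k.*2.+2] &
      exists h, [/\ h \in A, h \notin P |: S, adj Q h & forall s y, s \in S -> y \in A ->
        y \notin P |: S -> adj s y -> s = Q /\ y = h]].
Proof.
move=> kA /exceptionalP[SAP cS [cnS _] e].
have SA : S \subset A by apply: subset_trans SAP (subD1set _ _).
have PS : P \notin S by apply/negP => /(subsetP SAP); rewrite !inE eqxx.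
have S0 : S != set0 by case: cnS.
have fS := forestS SAP forest_theta.
have nS := exceptional_nb fS S0 PS e; have := vol_conn cnS; have := vol_forest fS S0;
  rewrite cS => v1 v2.
have ZA : P |: S \subset A by rewrite subUset sub1set PA.
have cZ : #|P |: S| = k.+1 by rewrite cardsU1 PS cS.
have := dsum_theta ZA; rewrite dsum_boundary // volU1 // setU11 cZ in_setU1 eq_sym (negbTE PQ) /=.
have b2 : 1 < boundary A (P |: S).
  apply: bridgeless => //; first by apply/set0Pn; exists P; rewrite setU11.
  by apply/eqP => eZ; move: kA; rewrite -eZ cZ ltnn.
have [QS|] := boolP (Q \in S) => /= eq; last by nlia.
have {}nS : nb S P = 2 by nlia.
have {}b2 : boundary A (P |: S) = 2 by nlia.
have nD : nb (A :\: (P |: S)) P = 1.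
  by have := nP; rewrite (nb_split P ZA) nbU1 // adj_irrefl nS; nlia.
have : dsum S (A :\: (P |: S)) = 1.
  by move: b2; rewrite /boundary {1}/dsum big_setU1 //= -/(dsum S _) nD; nlia.
case/dsum_eq1=> s [h [sS]]; rewrite inE => /andP[hZ hA] sh uniq.
have sQ : s = Q.
  apply/eqP/negPn/negP => sQ.
  have sP : s != P by apply: contraNneq PS => <-.
  have := d2 (subsetP SA s sS) sP sQ; rewrite (nb_split s ZA); have := e s sS.
  suff : 0 < nb (A :\: (P |: S)) s by nlia.
  by apply/nb_gt0P; exists h; rewrite // inE hZ.
split=> //; first by split=> //; nlia.
exists h; rewrite -sQ; split=> // x y xS yA yZ xy; apply: uniq => //; by rewrite inE yZ.
Qed.

(* For exceptional [S], let [h] be the neighbour of [Q] outside the cycle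
   [P |: S] and [q1] one on the cycle which is not a leaf of [S]: trading [Q] and
   [q1] for [P] and [h] isolates [h]. *)
Lemma ngood_theta k : 3 < k -> k.+2 < #|A| -> ngood A k <= 'C(#|A|.-1, k.-1).
Proof.
move=> k3 kA.
pose h S := odflt P [pick h in A :\: (P |: S) | adj Q h].
pose q1 S := odflt P [pick q in S | adj Q q & 1 < nb S q].
pose T S := P |: (h S |: (S :\ Q :\ q1 S)).
have facts S : S \in exceptional A P k ->
  [/\ [/\ S \subset A, P \notin S, #|S| = k, conn S & Q \in S],
      [/\ h S \in A, h S != P, h S \notin S & adj Q (h S)],
      ~~ adj P (h S) /\ forall s y, s \in S -> y \in A -> y \notin P |: S -> adj s y ->
        s = Q /\ y = h S &
      [/\ q1 S \in S, adj Q (q1 S) & 1 < nb S (q1 S)]].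
  move=> SE; have [[SA PS cS cnS] [QS nSP nDP vZ] [h0 [h0A h0Z Qh0 uniq]]] := exceptional_theta
    (ltnW kA) SE.
  have -> : h S = h0.
    rewrite /h; case: pickP => [x /andP[]|/(_ h0)]; last by rewrite inE h0Z h0A Qh0.
    by rewrite inE => /andP[xZ xA] Qx; have [] := uniq Q x QS xA xZ Qx.
  have [h0P h0S] : h0 != P /\ h0 \notin S by move: h0Z; rewrite !inE negb_or => /andP[].
  split=> //.
  (* If h were adjacent to both P and Q, the cycle with h would have no outgoing edge and would be
     all of A, of order k + 2. *)
  - split=> //; apply/negP => Ph0.
    have ZA : h0 |: (P |: S) \subset A by rewrite !subUset !sub1set h0A PA.
    suff eA : h0 |: (P |: S) = A by move: kA; rewrite -eA cardsU1 h0Z cardsU1 PS cS ltnn.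
    apply: (boundary_eq0 cA ZA); first by apply/set0Pn; exists h0; rewrite setU11.
    have n2 : 1 < nb (P |: S) h0.
      rewrite nbU1 // adj_sym Ph0 ltnS; apply/nb_gt0P; exists Q => //; by rewrite adj_sym.
    have := dsum_theta ZA;
      rewrite dsum_boundary // volU1 // vZ cardsU1 h0Z cardsU1 PS cS !inE eqxx QS !orbT /=.
    nlia.
  (* If all neighbours of Q in S were leaves of S, then S would consist of Q and at most two
     neighbours, against k > 3. *)
  - rewrite /q1; case: pickP => [x /and3P[]//|hn] /=.
    have /subset_leq_card : S \subset Q |: [set y in S | adj Q y].
      apply: (cnS.2 _ Q); rewrite ?setU11 // => x y /setU1P[->|]; rewrite !inE.
        by move=> _ -> ->; rewrite orbT.
      move=> /andP[xS Qx] _ yS xy; apply/orP; left; apply/negPn/negP => yQ.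
      have := hn x; rewrite xS Qx (nbD1 _ QS) adj_sym Qx ltnS => /negP[].
      by apply/nb_gt0P; exists y; rewrite // !inE yQ.
    rewrite cardsU1 cS; suff : nb S Q <= 2 by rewrite /nb; case: (_ \notin _) => /=; nlia.
    have := nQ; rewrite (nb_split Q SA); suff : 0 < nb (A :\: S) Q by nlia.
    by apply/nb_gt0P; exists h0; rewrite // inE h0S.
have iso S : S \in exceptional A P k -> nb (T S) (h S) = 0.
  case/facts=> [[SA PS cS cnS QS] [hA hP hS Qh] [Ph uniq] _].
  apply/eqP/nb0P => y; rewrite !in_setU1 !in_setD1 => /or3P[/eqP->|/eqP->|/and3P[_ yQ yS]].
  - by rewrite adj_sym.
  - by rewrite adj_irrefl.
  apply/negP; rewrite adj_sym => yh; have [|e _] := uniq y (h S) yS hA _ yh.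
    by rewrite in_setU1 negb_or hP.
  by rewrite e eqxx in yQ.
have TI : {in exceptional A P k &, injective T}.
  move=> S S' SE SE' eT.
  have [[SA PS cS cnS QS] [hA hP hS Qh] [Ph uniq] [qS Qq nq]] := facts S SE.
  have [[SA' PS' cS' cnS' QS'] [hA' hP' hS' Qh'] [Ph' uniq'] [qS' Qq' nq']] := facts S' SE'.
  have qnT X : X \in exceptional A P k -> q1 X \notin T X.
    case/facts=> [[_ PX _ _ _] [_ _ hX _] _ [qX _ _]].
    rewrite !in_setU1 !in_setD1 eqxx andFb orbF negb_or; apply/andP; split.
      by apply: contraNneq PX => <-.
    by apply: contraNneq hX => <-.
  have neQ x : adj Q x -> x != Q by move=> Qx; apply/eqP => e; rewrite e adj_irrefl in Qx.
  (* With equal h, [q1 S'] must also lie in S; as it is missing from the common spare set, it is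
     [q1 S], and S can be rebuilt. *)
  have [eh|neh] := eqVneq (h S) (h S').
    have eq1 : q1 S = q1 S'.
      apply/eqP/negPn/negP => neq; have := qnT S' SE'; rewrite -eT => /negP; apply.
      have q'S : q1 S' \in S.
        apply/negPn/negP => nS; have := hS'; rewrite -eh.
        have [|_ <-] := uniq Q (q1 S') QS (subsetP SA' _ qS') _ Qq'; rewrite ?qS' //.
        rewrite in_setU1 negb_or nS andbT; by apply: contraNneq PS' => <-.
      by rewrite !in_setU1 !in_setD1 (eq_sym (q1 S') (q1 S)) neq neQ // q'S !orbT.
    have rec X : X \in exceptional A P k -> X = Q |: (q1 X |: (T X :\ P :\ h X)).
      case/facts=> [[_ PX _ _ QX] [_ hPX hX _] _ [qX Qq0 _]]; rewrite /T.
      have hR : h X \notin X :\ Q :\ q1 X by rewrite !in_setD1 (negbTE hX) !andbF.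
      have PR : P \notin h X |: (X :\ Q :\ q1 X).
        by rewrite in_setU1 !in_setD1 (negbTE PX) !andbF orbF eq_sym.
      by rewrite setU1K // setU1K // setD1K ?setD1K // in_setD1 neQ.
    by rewrite (rec S SE) (rec S' SE') eT eh eq1.
  (* Now [h S'] lies in S but is isolated in the common spare set, so its two neighbours in [P |: S]
     are Q and [q1 S]. These three form a triangle avoiding P. *)
  have h'R : h S' \in S :\ Q :\ q1 S.
    have : h S' \in T S by rewrite eT !in_setU1 eqxx !orbT.
    by rewrite /T in_setU1 in_setU1 (negbTE hP') eq_sym (negbTE neh).
  have [h'q h'Q h'S] : [/\ h S' != q1 S, h S' != Q & h S' \in S].
    by move: h'R; rewrite !in_setD1 => /and3P[].
  have /exceptionalP[SAP _ _ eS] := SE.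
  have := eS _ h'S; have QZ : Q \in P |: S by rewrite in_setU1 QS orbT.
  have qZ : q1 S \in (P |: S) :\ Q by rewrite in_setD1 in_setU1 qS orbT neQ.
  rewrite (nbD1 _ QZ) (nbD1 _ qZ).
  have : nb ((P |: S) :\ Q :\ q1 S) (h S') <= nb (T S) (h S').
    apply: nbS; apply/subsetP => x; rewrite !inE => /and3P[-> -> /orP[->|->]] //;
      by rewrite !orbT.
  rewrite eT iso // leqn0 => /eqP->; case: (boolP (adj _ Q)) => // a1;
    case: (boolP (adj _ _)) => // a2 _.
  pose X := h S' |: (q1 S |: [set Q]).
  have XA : X \subset A :\ P.
    apply: subset_trans SAP; by rewrite !subUset !sub1set h'S qS.
  have X0 : X != set0 by apply/set0Pn; exists Q; rewrite !inE eqxx !orbT.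
  have qQ : q1 S \notin [set Q] by rewrite inE neQ.
  have hX : h S' \notin q1 S |: [set Q] by rewrite !inE negb_or h'q.
  have := vol_forest (forestS XA forest_theta) X0; rewrite volU1 // volU1 // nbU1 // a2.
  rewrite !cardsU1 hX qQ cards1 !nbE !big_set1 a1 adj_sym Qq /vol /dsum big_set1 nbE big_set1;
    nlia.
have := @ngood_hub G A P k (T @: exceptional A P k) PA forest_theta (ltnW k3).
rewrite (card_in_imset TI) leq_add2r; apply=> _ /imsetP[S SE ->].
have is0 := iso S SE.
have [[SA PS cS cnS QS] [hA hP hS Qh] [Ph uniq] [qS Qq nq]] := facts S SE.
have qQ : q1 S != Q by apply/eqP => e; rewrite e adj_irrefl in Qq.
have RS : S :\ Q :\ q1 S \subset S by rewrite (subset_trans (subD1set _ _)) ?subD1set.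
have hR : h S \notin S :\ Q :\ q1 S by apply: contra hS; apply: (subsetP RS).
have PR : P \notin h S |: (S :\ Q :\ q1 S).
  rewrite in_setU1 eq_sym (negbTE hP); apply: contra PS; exact: (subsetP RS).
have cR : #|S :\ Q :\ q1 S| = k - 2.
  by move: cS; rewrite (cardsD1 Q) QS (cardsD1 (q1 S) (S :\ Q)) in_setD1 qQ qS; nlia.
have cT : #|T S| = k by rewrite /T !cardsU1 PR hR cR; nlia.
have hZ : h S \notin P |: S by rewrite in_setU1 negb_or hP.
split=> //.
- by rewrite /T !subUset !sub1set PA hA (subset_trans RS).
- by rewrite setU11.
- case=> cn _; have : 0 < nb (T S) (h S) by apply: conn_nb_gt0;
  rewrite ?cT ?in_setU1 ?eqxx ?orbT //; nlia.
  by rewrite is0.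
right=> y yA yT [cn _]; exfalso; move: cn; rewrite /T setU1K // => cn.
have yR : y \notin h S |: (S :\ Q :\ q1 S) by apply: contra yT => yR; rewrite in_setU1 yR orbT.
have cY : #|y |: (h S |: (S :\ Q :\ q1 S))| = k by rewrite !cardsU1 yR hR cR; nlia.
have hy : adj (h S) y.
  have /nb_gt0P[x] : 0 < nb (y |: (h S |: (S :\ Q :\ q1 S))) (h S).
    by apply: conn_nb_gt0; rewrite ?cY ?in_setU1 ?eqxx ?orbT //; nlia.
  case/setU1P=> [-> //|xR hx]; move/eqP/nb0P: is0 => /(_ x); rewrite /T in_setU1 xR orbT hx.
  by move=> /(_ isT).
(* Restoring Q gives the tree S without its inner vertex [q1 S], plus [h S] hanging on Q: too few
   edges to be connected. *)
have [yQ|yQ] := eqVneq y Q.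
  have eY : y |: (h S |: (S :\ Q :\ q1 S)) = h S |: (S :\ q1 S).
    have -> : S :\ Q :\ q1 S = S :\ q1 S :\ Q by rewrite !setDDl setUC.
    by rewrite setUCA yQ setD1K // in_setD1 eq_sym qQ QS.
  have := vol_conn cn; rewrite cY eY volU1; last by rewrite in_setD1 (negbTE hS) andbF.
  have S0 : S != set0 by case: cnS.
  have /exceptionalP[SAP _ _ _] := SE.
  have := vol_forest (forestS SAP forest_theta) S0; rewrite (volD1 qS) cS.
  have : nb (S :\ q1 S) (h S) <= 1.
    apply: leq_trans (nbS _ (subD1set _ _)) _; rewrite (nbD1 _ QS).
    suff /eqP-> : nb (S :\ Q) (h S) == 0 by case: adj.
    apply/nb0P => x; rewrite in_setD1 => /andP[xQ xS]; apply/negP; rewrite adj_sym => xh.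
    by have [e _] := uniq x (h S) xS hA hZ xh; rewrite e eqxx in xQ.
  nlia.
have yS : y \notin S.
  apply/negP => yS; have [|e _] := uniq y (h S) yS hA hZ; first by rewrite adj_sym.
  by rewrite e eqxx in yQ.
have yZ : y \notin P |: S.
  rewrite in_setU1 negb_or yS andbT; by apply: contraNneq yT => ->; rewrite setU11.
(* Neither h nor y has a neighbour in S other than Q, which is absent, so they form a component by
   themselves. *)
have /subset_leq_card : y |: (h S |: (S :\ Q :\ q1 S)) \subset [set h S; y].
  apply: (cn.2 _ (h S)); rewrite ?inE ?eqxx ?orbT // => u v; rewrite !in_setU1 !in_set1 !in_setD1.
  case/orP=> /eqP-> _ /or3P[/eqP->|/eqP->|/and3P[vq vQ vS] uv]; rewrite ?eqxx ?orbT //.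
    have [|e _] := uniq v (h S) vS hA hZ; first by rewrite adj_sym.
    by rewrite e eqxx in vQ.
  have [|e _] := uniq v y vS yA yZ; first by rewrite adj_sym.
  by rewrite e eqxx in vQ.
rewrite cY cards2; case: (_ != _) => /=; nlia.
Qed.

(* Exceptional sets correspond to common neighbours of [P] and [Q].  The spare
   sets are [A :\ Q :\ z], disconnected if [z] is adjacent neither to [P] nor to
   [Q], and, if [P] and [Q] are not adjacent, [A] without two adjacent vertices of
   degree 2, which contains a cycle of length at least 4. *)
Lemma ngood_theta_minus2 k : 3 < k -> k.+2 = #|A| -> ngood A k <= 'C(#|A|.-1, k.-1) + (#|A| == 6).
Proof.
move=> k3 kA.
pose N x := [set y in A | adj x y].
pose H := N P :&: N Q.
pose Zs := [set z in A | [&& z != P, z != Q, ~~ adj P z & ~~ adj Q z]].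
have k1A : k.+1 < #|A| by rewrite -kA.
have eH : #|exceptional A P k| <= #|H|.
  apply: leq_trans (leq_imset_card (fun h => A :\ P :\ h) H); apply: subset_leq_card.
  apply/subsetP => S SE;
    have [[SA PS cS cnS] [QS nSP nDP vZ] [h [hA hZ Qh uniq]]] := exceptional_theta k1A SE.
  have cD : #|A :\: (P |: S)| == 1.
    rewrite cardsD (setIidPr _); last by rewrite subUset sub1set PA.
    by rewrite cardsU1 PS cS -kA -addn1 addSn subSS -addSnnS; apply/eqP; nlia.
  have hD : h \in A :\: (P |: S) by rewrite inE hZ.
  have [d eD] := cards1P cD; move: hD; rewrite eD inE => /eqP ed; rewrite -{}ed in eD.
  have Ph : adj P h.
    have /nb_gt0P[y] : 0 < nb (A :\: (P |: S)) P by rewrite nDP.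
    by rewrite eD inE => /eqP->.
  apply/imsetP; exists h; first by rewrite !inE hA Ph.
  have ZA : P |: S \subset A by rewrite subUset sub1set PA.
  by rewrite setDDl setUC -setDDl -{1}eD setDDr setDv set0U (setIidPr ZA) setU1K.
have cN : #|N P :|: N Q| + #|H| = 6 by rewrite cardsUI -/(nb A P) -/(nb A Q) nP nQ.
(* So |Zs| >= |A| - 6 + |H|, or two less if P and Q are not adjacent; there the extra spare set T
   regains one. Since |A| >= 6, a deficit is left only for |A| = 6, and it is one. *)
have cZ : #|A| <= #|Zs| + #|N P :|: N Q| + (~~ adj P Q).*2.
  have : A \subset Zs :|: (N P :|: N Q) :|: (if adj P Q then set0 else [set P; Q]).
    apply/subsetP => x xA; rewrite !in_setU !orbA; have [//|] := boolP (x \in Zs).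
    rewrite inE xA /= !negb_and !negbK => /or4P[/eqP->|/eqP->|Px|Qx].
    - by case: ifP => PQa; rewrite !inE ?eqxx ?orbT // PA adj_sym PQa orbT.
    - by case: ifP => PQa; rewrite !inE ?eqxx ?orbT // QA PQa.
    - by rewrite [x \in N P]inE xA Px.
    - by rewrite [x \in N Q]inE xA Qx orbT.
  move/subset_leq_card/leq_trans; apply.
  apply: leq_trans (leq_card_setU _ _) _; apply: leq_add; first exact: leq_card_setU.
  by case: ifP; rewrite ?cards0 // cards2 PQ.
have fP := forest_theta.
have cutQ : ~ conn (A :\ P :\ Q).
  apply: forest_cut fP _ _; first by rewrite !inE eq_sym PQ.
  by move: nQ; rewrite (nbD1 _ PA); case: adj => /=; nlia.
have cutz z : z \in Zs -> ~ conn (A :\ P :\ z).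
  rewrite inE => /and5P[zA zP zQ Pz Qz]; apply: forest_cut fP _ _; first by rewrite !inE zP.
  by have := d2 zA zP zQ; rewrite (nbD1 _ PA) adj_sym (negbTE Pz) add0n => ->.
pose Sp1 := (fun z => A :\ Q :\ z) @: Zs.
have cSp1 : #|Sp1| = #|Zs|.
  apply: card_in_imset => z z'; rewrite inE => /and5P[zA zP zQ Pz Qz] _ /setP/(_ z).
  by rewrite !inE eqxx zQ zA /= => /esym; case: eqP.
have hub1 T : T \in Sp1 -> [/\ T \subset A, #|T| = k, P \in T, ~ good T &
    conn T \/ forall y, y \in A -> y \notin T -> good (y |: (T :\ P)) -> y |: (T :\ P) \in
      exceptional A P k].
  case/imsetP=> z zZ ->; have := zZ; rewrite inE => /and5P[zA zP zQ Pz Qz].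
  have zAQ : z \in A :\ Q by rewrite !inE zQ.
  have cT : #|A :\ Q :\ z| = k by move: kA; rewrite (cardsD1 Q) QA (cardsD1 z (A :\ Q)) zAQ; nlia.
  split=> //.
  - by rewrite (subset_trans (subD1set _ _)) ?subD1set.
  - by rewrite !inE eq_sym zP PQ.
  - case=> /vol_conn; rewrite cT => vT _; have := vA; rewrite (volD1 QA) (volD1 zAQ) nQ.
    by have := d2 zA zP zQ; rewrite (nbD1 _ QA) adj_sym (negbTE Qz) -kA; nlia.
  right=> y yA; rewrite !in_setD1 yA andbT negb_and !negbK => /orP[/eqP->|/eqP->] [cn _]; exfalso.
    apply: (cutQ); move: cn; rewrite (_ : z |: _ = A :\ P :\ Q) //.
    apply/setP => x; rewrite !inE; case: (eqVneq x z) => [->|] //=; first by rewrite zQ zP zA.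
    by rewrite andbCA.
  apply: (cutz z zZ); move: cn; rewrite (_ : Q |: _ = A :\ P :\ z) //.
  apply/setP => x; rewrite !inE; case: (eqVneq x Q) => [->|] //=; last by rewrite andbCA.
  by rewrite (eq_sym Q z) zQ (eq_sym Q P) PQ QA.
have [PQa|PQn] := boolP (adj P Q).
  have := @ngood_hub G A P k Sp1 PA fP (ltnW k3) hub1; rewrite cSp1; move: cZ cN eH kA k3;
    rewrite PQa /=.
  move: #|H| #|Zs| #|N P :|: N Q| #|exceptional A P k| #|A| ('C(_, _)) (ngood A k); clear;
    move=> *; lia.
have [z [z' [zO z'O zz']]] : exists z z', [/\ z \in A :\ P :\ Q, z' \in A :\ P :\ Q & adj z z'].
  apply/dsum_gt0P; rewrite -/(vol _).
  have QAP : Q \in A :\ P by rewrite !inE eq_sym PQ.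
  have := vA; rewrite (volD1 PA) (volD1 QAP) nP; have := nQ;
    rewrite (nbD1 _ PA) adj_sym (negbTE PQn).
  by rewrite -kA; nlia.
move: zO z'O; rewrite !inE => /and3P[zQ zP zA] /and3P[z'Q z'P z'A].
have zz : z != z' by apply/eqP => e; rewrite e adj_irrefl in zz'.
pose T := A :\ z :\ z'.
have TA : T \subset A by rewrite (subset_trans (subD1set _ _)) ?subD1set.
have z'Az : z' \in A :\ z by rewrite !inE eq_sym zz.
have cT : #|T| = k by move: kA; rewrite (cardsD1 z) zA (cardsD1 z' (A :\ z)) z'Az -/T; nlia.
have vT : vol T = #|T|.*2.
  have := vA; rewrite (volD1 zA) (volD1 z'Az) -/T d2 //.
  by have := d2 z'A z'P z'Q; rewrite (nbD1 _ zA) adj_sym zz' cT -kA; nlia.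
(* Only two edges join T to the removed pair W, but each part of a split T would by bridgelessness
   send at least two edges to W. *)
have cnT : conn T.
  pose W := [set z; z']; have WA : W \subset A by rewrite subUset !sub1set zA.
  have TW : T = A :\: W by rewrite /T setDDl.
  have WT2 : dsum T W = 2.
    rewrite dsumC TW -/(boundary A W).
    have := dsum_theta WA;
      rewrite dsum_boundary // cards2 zz !inE (eq_sym P) (negbTE zP) (eq_sym P) (negbTE z'P).
    rewrite (eq_sym Q) (negbTE zQ) (eq_sym Q) (negbTE z'Q) /W setUC volU1 ?inE 1?eq_sym //.
    by rewrite nbE big_set1 adj_sym zz' /vol /dsum big_set1 nbE big_set1 adj_irrefl; nlia.
  split; first by rewrite -card_gt0 cT; nlia.
  move=> X x0 x0X x0T clX; apply/negPn/negP => /subsetPn[y0 y0T y0X].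
  have side Y : Y \subset T -> Y != set0 -> Y != T -> dsum Y (T :\: Y) = 0 -> 1 < dsum Y W.
    move=> YT Y0 YnT d0; have YA := subset_trans YT TA.
    have YnA : Y != A.
      apply/eqP => e; have := subset_leq_card YT; rewrite e cT -kA; nlia.
    have := bridgeless YA Y0 YnA; rewrite /boundary.
    have WAY : W \subset A :\: Y.
      apply/subsetP => x xW; rewrite inE (subsetP WA) // andbT; apply/negP => /(subsetP YT).
      by rewrite TW inE xW.
    rewrite (dsum_splitr _ WAY) setDDl setUC -setDDl -TW d0; nlia.
  have d0 : dsum (T :&: X) (T :\: X) = 0.
    apply/eqP; rewrite -leqn0 leqNgt; apply/dsum_gt0P => -[u [v]].
    case=> /setIP[uT uX] /setDP[vT' vX] uv; by rewrite (clX u v) in vX.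
  have := side (T :&: X); have := side (T :\: X).
  rewrite setDIr setDv set0U d0 setDDr setDv set0U dsumC d0 !subsetIl subsetDl.
  have -> : T :\: X != set0 by apply/set0Pn; exists y0; rewrite inE y0X.
  have -> : T :&: X != set0 by apply/set0Pn; exists x0; rewrite inE x0X x0T.
  have -> : T :\: X != T by apply/eqP => /setP/(_ x0); rewrite in_setD x0X x0T.
  have -> : T :&: X != T by apply/eqP => /setP/(_ y0); rewrite in_setI (negbTE y0X) y0T.
  move=> /(_ isT isT isT erefl) d1 /(_ isT isT isT erefl) d1'.
  have := dsum_splitl W (subsetIl T X); rewrite setDIr setDv set0U WT2; nlia.
(* T has as many edges as vertices, hence a core through P and Q; it is not a triangle because P and
   Q are not adjacent. *)
have ngT : ~ good T.
  have T0 : T != set0 by case: cnT.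
  case=> _ nev; have [|X [XT X0 nX]] := has_core T0; first by rewrite vT.
  have XA := subset_trans XT TA.
  have XnA : X != A.
    by apply/eqP => e; have := subset_leq_card XT; rewrite e cT -kA; nlia.
  apply: (nev X); apply: core_evasive => //; rewrite ltnNge; apply/negP => X3.
  have [PX QX _ nX2] := core_theta XA X0 XnA nX.
  have [|v [eX vP vQ]] := @triangle_core X _ PX QX; first by apply/eqP;
    rewrite eqn_leq X3 core_card.
  have := nX P PX; rewrite (nbD1 _ QX) (negbTE PQn) eX.
  have -> : [set P; Q; v] :\ Q = [set P; v].
    apply/setP => x; rewrite !inE; case: (eqVneq x Q) => [->|] /=; rewrite ?orbF //.
    by rewrite eq_sym (negbTE PQ) eq_sym (negbTE vQ).
  rewrite setUC nbU1 ?inE // nbE big_set1 adj_irrefl; by case: adj.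
have := @ngood_hub G A P k (T |: Sp1) PA fP (ltnW k3).
have TSp : T \notin Sp1.
  apply/imsetP => -[y _ /setP/(_ Q)]; rewrite !inE eqxx QA (eq_sym Q) z'Q (eq_sym Q) zQ andbF.
  by [].
rewrite cardsU1 TSp cSp1 => H'.
suff : ngood A k + (true + #|Zs|) <= 'C(#|A|.-1, k.-1) + #|exceptional A P k|.
  move: cZ cN eH kA k3; rewrite PQn /=.
  move: #|H| #|Zs| #|N P :|: N Q| #|exceptional A P k| #|A| ('C(_, _)) (ngood A k); clear;
    move=> *; lia.
apply: H' => T' /setU1P[->|/hub1//]; split=> //; last by left.
by rewrite !inE eq_sym z'P eq_sym zP.
Qed.

End Theta.

(** * Induction on leaves *)

(** The two binomials are the extreme terms of Vandermonde's sum; an adjacent inner term, at least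
    two whenever an indicator is 1, pays for both indicators. *)
Lemma bin_bridge a b m : 1 < a -> 1 < b -> 1 < m ->
  'C(a, m) + (m < a) + 'C(b, m) + (m < b) <= 'C(a + b, m).
Proof.
case: m => [|[|m]] // a1 b1 _; rewrite -binomial.Vandermonde big_ord_recl big_ord_recr /=.
rewrite bin0 mul1n subn0 /bump /= add1n subnn bin0 muln1.
set s := \sum_(i < _) _.
suff : (m.+2 < a) + (m.+2 < b) <= s.
  by move: s ('C(a, _)) ('C(b, _)) => s u v; nlia.
have [ma|ma] := boolP (m.+2 < a).
  have : 'C(a, m.+1) * b <= s.
    by rewrite /s big_ord_recr /= /bump /= add1n subSnn bin1 leq_addl.
  have : 0 < 'C(a, m.+1) by rewrite bin_gt0; lia.
  by move: s ('C(a, _)) => s u; case: (_ < b) => /=; clear -a1 b1; nia.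
have [mb|//] := boolP (m.+2 < b).
have : a * 'C(b, m.+1) <= s.
  by rewrite /s big_ord_recl /= /bump /= add1n bin1 subSS subn0 leq_addr.
have : 0 < 'C(b, m.+1) by rewrite bin_gt0; lia.
by move: s ('C(b, _)) => s u; clear -a1 b1; rewrite add0n; nia.
Qed.

Section Bicyclic.
Variable G : sgraph.
Implicit Types (A B C S T X Y Z : {set G}) (x y z c p q r s h : G).

Lemma odd_vol X : odd (vol X) = false.
Proof.
have [n] := ubnP #|X|; elim: n X => // n IH X Xn.
have [->|/set0Pn[x xX]] := eqVneq X set0; first by rewrite /vol /dsum big_set0.
rewrite (volD1 xX) oddD odd_double addbF IH //.
by move: Xn; rewrite (cardsD1 x) xX; nlia.
Qed.

Lemma bicyclic_set_gt1 A : bicyclic_set A -> 1 < #|A|.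
Proof.
case=> _ vA; have : vol A <= #|A| * #|A|.-1.
  by apply: dsum_le => x xA; have := nb_lt xA; nlia.
by rewrite vA; move: #|A| => m; nia.
Qed.

Lemma bicyclic_set_sub2 A : bicyclic_set A -> (forall x, x \in A -> 1 < nb A x) -> \sum_(x in A)
  (nb A x - 2) = 2.
Proof.
move=> [_ vA] n2; apply/eqP; rewrite -(eqn_add2l (#|A| * 2)) -sum_nat_const -big_split /=.
rewrite (eq_bigr (nb A)); last by move=> x /n2; move: (nb A x) => d; nlia.
rewrite -/(dsum A A) -/(vol A) vA sum_nat_const; apply/eqP; nlia.
Qed.

(** The total degree excess over 2 is exactly 2, carried by one vertex or shared by two. *)
Lemma leafless_shape A : bicyclic_set A -> (forall x, x \in A -> 1 < nb A x) ->
  (exists2 c, c \in A & nb A c = 4 /\ forall x, x \in A -> x != c -> nb A x = 2) \/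
  exists P Q, [/\ [/\ P \in A, Q \in A & P != Q], nb A P = 3, nb A Q = 3 &
    forall x, x \in A -> x != P -> x != Q -> nb A x = 2].
Proof.
move=> bA n2; have s2 := bicyclic_set_sub2 bA n2.
have zero B : B \subset A -> \sum_(x in B) (nb A x - 2) = 0 -> forall x, x \in B -> nb A x = 2.
  move=> BA /eqP; rewrite sum_nat_eq0 => /forall_inP h x xB.
  by have := h x xB; have := n2 x (subsetP BA x xB); move: (nb A x) => d; nlia.
have pick B : 0 < \sum_(x in B) (nb A x - 2) -> exists2 x, x \in B & 2 < nb A x.
  move=> pos; apply: contrapT => hn; move: pos; rewrite big1 // => x xB.
  apply/eqP; rewrite subn_eq0 leqNgt; by apply/negP => nx; apply: hn; exists x.
have [|P PA nP] := pick A; first by rewrite s2.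
move: s2; rewrite (big_setD1 P PA) /= => s2.
have [d4|d4] := eqVneq (nb A P) 4.
  left; exists P => //; split=> // x xA xP; apply: (zero (A :\ P)); rewrite ?subD1set ?inE ?xP //.
  by move: s2; rewrite d4; nlia.
have P3 : nb A P = 3 by move: s2 nP d4; move: (nb A P) (\sum_(x in _) _) => d e; nlia.
have [|Q QA nQ] := pick (A :\ P); first by move: s2; rewrite P3; nlia.
move: s2; rewrite (big_setD1 Q QA) /= P3 => s2.
have [QP QA'] : Q != P /\ Q \in A by move: QA; rewrite !inE => /andP[].
right; exists P, Q; split=> //; first by rewrite eq_sym.
  by move: s2 nQ; move: (nb A Q) (\sum_(x in _) _) => d e; nlia.
move=> x xA xP xQ; apply: (zero (A :\ P :\ Q)); rewrite ?inE ?xP ?xQ //.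
  by rewrite (subset_trans (subD1set _ _)) ?subD1set.
by move: s2 nQ; move: (nb A Q) (\sum_(x in _) _) => d e; nlia.
Qed.

(* The exception occurs: two vertices joined by three disjoint paths of lengths
   2, 2 and 3 have 11 > C(5,3) good 4-sets. *)
Lemma leafless_ngood A k : bicyclic_set A -> (forall x, x \in A -> 1 < nb A x) -> 3 < k ->
  ngood A k <= 'C(#|A|.-1, k.-1) \/
  [/\ #|A| = 6, k = 4, ngood A k <= 11 & forall x, x \in A -> nb A x <= 3].
Proof.
move=> bA n2 k3; have [cA vA] := bA.
case: (leafless_shape bA n2) => [[c cinA [n4 d2]]|[P [Q [[PA QA PQ] nP nQ d2]]]].
  by left; apply: (ngood_deg4 bA cinA n4 d2).
have [[X [XA bX]]|nobridge] := EM (exists X, X \subset A /\ boundary A X = 1).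
  left; wlog PX : X XA bX / P \in X.
    move=> W; have [|PX] := boolP (P \in X); first exact: W.
    apply: (W (A :\: X)); rewrite ?subsetDl ?inE ?PX //.
    by rewrite /boundary setDDr setDv set0U (setIidPr XA) dsumC.
  (* By parity: the degree sum over X is [vol X] + 1, hence odd, so just one vertex of degree three
     lies in X. *)
  have QX : Q \notin X.
    have := dsum_theta PQ nP nQ d2 XA; rewrite dsum_boundary // bX PX => e.
    apply/negP => QX; move: e; rewrite QX => /(congr1 odd); rewrite !oddD odd_vol odd_double.
    by [].
  have [a3 fX] : 2 < #|X| /\ ngood X k <= 'C(#|X|.-1, k.-1) + (k < #|X|).
    apply: (ngood_side cA XA PX nP) => //; last exact: ltnW.
    move=> x xX xP; apply: d2 => //; first exact: (subsetP XA).
    by apply: contraNneq QX => <-.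
  have [b3 fY] : 2 < #|A :\: X| /\ ngood (A :\: X) k <= 'C(#|A :\: X|.-1, k.-1) + (k < #|A :\:
    X|).
    apply: (@ngood_side G A (A :\: X) Q k cA) => //; rewrite ?subsetDl ?inE ?QX //; last first.
    - by rewrite /boundary setDDr setDv set0U (setIidPr XA) dsumC.
    - exact: ltnW.
    - move=> x; rewrite inE => /andP[xX xA] xQ; apply: d2 => //; by apply: contraNneq xX => ->.
  have := ngood_bridge XA bX (ltnW (ltnW k3)).
  have := cardsID X A; rewrite (setIidPr XA) => cAX.
  move: fX fY; move: (ngood X k) (ngood (A :\: X) k) (ngood A k) => u v w; rewrite -cAX.
  move: a3 b3 k3; case: #|X| => // a; case: #|A :\: X| => // b; case: k => [|[|[|k]]] // a1 b1 k3.
  (* The sides have a + 1 and b + 1 vertices and [k.+2] is the original k minus 1; Pascal's rule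
     adds the bridge term. *)
  have := @bin_bridge a b k.+2 a1 b1 isT;
    rewrite /= addSn addnS /= binS subSS subSS subn0 !subSS subn0.
  by rewrite !ltnS; move: ('C(a, _)) ('C(b, _)) ('C(a + b, k.+2)) ('C(a + b, k.+1)) => *; nlia.
have bb X : X \subset A -> X != set0 -> X != A -> 1 < boundary A X.
  move=> XA X0 XnA; have b0 : boundary A X != 0.
    by apply: contraNneq XnA => b0; apply/eqP; apply: boundary_eq0.
  have b1 : boundary A X != 1 by apply/eqP => b1; apply: nobridge; exists X.
  by move: b0 b1; move: (boundary A X) => d; nlia.
have [kA|kA|kA] := ltngtP k #|A|; last 2 first.
- by left; rewrite ngood_small.
- by left; rewrite kA binn; apply: ngood_full.
have [k1|k1|k1] := ltngtP k.+1 #|A|; last 2 first.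
- by exfalso; nlia.
- by left; apply: (ngood_theta_minus1 bA PA QA PQ nP nQ d2 bb).
have [k2|k2|k2] := ltngtP k.+2 #|A|; last 2 first.
- by exfalso; nlia.
- have := ngood_theta_minus2 bA PA QA PQ nP nQ d2 bb k3 k2.
  have [A6|A6] := eqVneq #|A| 6; last by rewrite addn0 => f11; left.
  have k4 : k = 4 by apply/eqP; rewrite -2!eqSS k2 A6.
  move=> f11; right; split=> //; first by move: f11; rewrite A6 k4.
  move=> x xA; have [->|xP] := eqVneq x P; first by rewrite nP.
  by have [->|xQ] := eqVneq x Q; [rewrite nQ | rewrite d2].
by left; apply: (ngood_theta bA PA PQ nP nQ d2 bb).
Qed.

Lemma bicyclic_set_leaf A x : bicyclic_set A -> x \in A -> nb A x = 1 -> bicyclic_set (A :\ x).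
Proof.
move=> bA xA nx; have [cA vA] := bA; have A1 := bicyclic_set_gt1 bA.
have cAx := cardsD1 x A; rewrite xA in cAx; split; last first.
  by move: vA; rewrite (volD1 xA) nx cAx; nlia.
split; first by rewrite -card_gt0; move: A1; rewrite cAx; nlia.
move=> X x0 x0X; rewrite !inE => /andP[x0x x0A] clX.
have /nb_gt0P[u uA xu] : 0 < nb A x by rewrite nx.
have onlyu y : y \in A -> adj x y -> y = u.
  move=> yA xy; apply/eqP/negPn/negP => yu; move: nx; rewrite (nbD1 _ uA) xu => -[] /eqP/nb0P.
  by move=> /(_ y); rewrite !inE yu yA xy => /(_ isT).
have [uX|uX] := boolP (u \in X).
  suff AX : A \subset x |: X.
    apply/subsetP => y; rewrite !inE => /andP[yx /(subsetP AX)]; by rewrite !inE (negbTE yx).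
  apply: (cA.2 _ x0) => //; first by rewrite !inE x0X orbT.
  move=> y z; rewrite !inE => /orP[/eqP->|yX] yA zA yz; first by rewrite (onlyu z) // uX orbT.
  have [//|zx] := eqVneq z x; have [yx|yx] := eqVneq y x; first by rewrite (onlyu z) // -yx.
  by rewrite (clX y z) ?inE ?yx ?zx.
suff AX : A \subset X :\ x.
  by have := subsetP AX x xA; rewrite !inE eqxx.
apply: (cA.2 _ x0) => //; first by rewrite !inE x0x.
move=> y z; rewrite !inE => /andP[yx yX] yA zA yz; have [zx|zx] := eqVneq z x.
  by case/negP: uX; rewrite -(onlyu y) // -zx adj_sym.
by rewrite /= (clX y z) ?inE ?yx ?zx.
Qed.

(** A leaf x is one side of a bridge and Pascal's rule closes the induction. Above the exceptional
    case the slack must be found by hand: good 4-sets through x contain its neighbour u, which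
    leaves 10 candidates, one of them bad, and 11 + 9 = C(6,3). *)
Lemma bicyclic_set_ngood A k : bicyclic_set A -> 3 < k ->
  ngood A k <= 'C(#|A|.-1, k.-1) \/
  [/\ #|A| = 6, k = 4, ngood A k <= 11 & forall x, x \in A -> nb A x <= 3].
Proof.
have [n] := ubnP #|A|; elim: n A => // n IH A An bA k3.
have [n2|[x xA nx]] : (forall x, x \in A -> 1 < nb A x) \/ exists2 x, x \in A & nb A x <= 1.
  have [|hn] := EM (exists2 x, x \in A & nb A x <= 1); first by right.
  by left=> x xA; rewrite ltnNge; apply/negP => nx; apply: hn; exists x.
  exact: leafless_ngood.
have A1 := bicyclic_set_gt1 bA.
have {}nx : nb A x = 1 by apply/eqP; rewrite eqn_leq nx; apply: conn_nb_gt0 => //; case: bA.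
have cAx := cardsD1 x A; rewrite xA in cAx.
have bAx := bicyclic_set_leaf bA xA nx; have Ax1 := bicyclic_set_gt1 bAx.
have [|H|[A6 k4 f11 d3]] := IH (A :\ x) _ bAx k3; first by move: An; rewrite cAx; nlia.
  left; have b1 : boundary A [set x] = 1 by rewrite /boundary dsum1 nb_self.
  have xA' : [set x] \subset A by rewrite sub1set.
  have := ngood_bridge xA' b1 (ltnW (ltnW k3)); rewrite (@ngood_small _ [set x]);
    last by rewrite cards1; nlia.
  rewrite addn0; clear IH; move: H Ax1; rewrite cAx; case: #|A :\ x| => // a;
    case: k k3 => [|[|k]] // _.
  rewrite /= add1n /= !subSS !subn0 binS;
    move: (ngood A _) (ngood (A :\ x) _) ('C(_, _)) ('C(_, _)) => *; nlia.
subst k; left; have /nb_gt0P[u uA xu] : 0 < nb A x by rewrite nx.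
have ux : u != x by apply/eqP => e; rewrite e adj_irrefl in xu.
have onlyu y : y \in A -> adj x y -> y = u.
  move=> yA xy; apply/eqP/negPn/negP => yu; move: nx; rewrite (nbD1 _ uA) xu => -[] /eqP/nb0P.
  by move=> /(_ y); rewrite !inE yu yA xy => /(_ isT).
have uAx : u \in A :\ x by rewrite !inE ux.
pose B := A :\ x :\ u.
have cB : #|B| = 5 by move: A6; rewrite (cardsD1 u) uAx -/B; nlia.
(* Among the five other vertices u has at most three neighbours; two non-neighbours p, q with x and
   u form the disconnected candidate [F]. *)
have /card_gt1P[p [q [pD qD pq]]] : 1 < #|[set y in B | ~~ adj u y]|.
  have := d3 u uAx; rewrite -nb_self -/B /nb => n3.
  have := cardsID [set y in B | adj u y] B; rewrite cB (setIidPr _); last first.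
    by apply/subsetP => y; rewrite inE => /andP[].
  suff -> : B :\: [set y in B | adj u y] = [set y in B | ~~ adj u y] by nlia.
  by apply/setP => y; rewrite in_setD in_set in_set; case: (y \in B); case: adj.
move: pD qD; rewrite !inE => /andP[/and3P[pu px pA] up] /andP[/and3P[qu qx qA] uq].
pose D := [set S : {set G} | [&& S \subset A, #|S| == 4 & [set x; u] \subset S]].
have xu2 : #|[set x; u]| = 2 by rewrite cards2 eq_sym ux.
have cD : #|D| = 10.
  by rewrite card_supersets ?xu2 // ?subUset ?sub1set ?xA ?uA // cAx A6.
pose F := [set x; u] :|: [set p; q].
have FD : F \in D.
  rewrite inE subsetUl andbT !subUset !sub1set xA uA pA qA /= cardsU xu2 cards2 pq.
  rewrite disjoint_setI0 ?cards0 // disjoints_subset subUset !sub1set !inE.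
  by rewrite !negb_or (eq_sym x) px (eq_sym u) pu (eq_sym x) qx (eq_sym u) qu.
have nF : ~ good F.
  case=> -[_ cF] _; have /subsetP/(_ p) : F \subset [set x; u].
    apply: (cF _ x); rewrite ?inE ?eqxx // => y z; rewrite !inE => /orP[]/eqP-> _.
      move=> zF; have zA : z \in A by case/orP: zF => /orP[]/eqP->.
      by move/(onlyu z zA)->; rewrite eqxx orbT.
    case/orP=> /orP[]/eqP->; rewrite ?eqxx ?orbT //; last by rewrite (negbTE uq).
    by rewrite (negbTE up).
  by rewrite !inE eqxx (negbTE px) (negbTE pu) !orbT => /(_ isT).
have : ngood A 4 <= #|good_sets (A :\ x) 4 :|: (D :\ F)|.
  apply: subset_leq_card; apply/subsetP => S /good_setsP[SA cS gS]; rewrite in_setU.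
  have [xS|xS] := boolP (x \in S); last by rewrite (introT (good_setsP _ _ _)) // subsetD1 SA xS.
  apply/orP; right; rewrite !inE SA cS subUset !sub1set xS eqxx /=; apply/andP; split.
    by apply/eqP => e; apply: nF; rewrite -e.
  have /nb_gt0P[y yS xy] : 0 < nb S x by apply: conn_nb_gt0; rewrite ?cS //; case: gS.
  by rewrite -(onlyu y (subsetP SA y yS) xy).
have [+ _] := leq_card_setU (good_sets (A :\ x) 4) (D :\ F).
have := cardsD1 F D; rewrite FD cD -/(ngood _ 4) cAx A6.
have -> : 'C((true + 6).-1, 4.-1) = 20 by [].
by move: f11; move: (ngood A 4) (ngood (A :\ x) 4) #|_ :|: _| #|_ :\ F| => *; nlia.
Qed.

End Bicyclic.

(** * Sets of three vertices *)

Lemma bin2D a b : 'C(a + b, 2) = 'C(a, 2) + 'C(b, 2) + a * b.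
Proof.
elim: b => [|b IH]; first by rewrite addn0 muln0 bin0n !addn0.
by rewrite addnS !binS !bin1 IH mulnS; nlia.
Qed.

Section Edges.
Variable G : sgraph.
Implicit Types (A B C S T X Y Z : {set G}) (x y z c p q r s h : G).

Definition edges_in X := [set e in edges G | e \subset X].

Lemma edgeP (e : {set G}) : reflect (exists x y, adj x y /\ e = [set x; y]) (e \in edges G).
Proof.
apply: (iffP imsetP) => [[[x y]]|[x [y [xy ->]]]]; last by exists (x, y); rewrite ?inE.
by rewrite inE /= => xy ->; exists x, y.
Qed.

Lemma edges_inP X (e : {set G}) :
  reflect (exists x y, [/\ x \in X, y \in X, adj x y & e = [set x; y]]) (e \in edges_in X).
Proof.
rewrite inE; apply: (iffP andP) => [[/edgeP[x [y [xy ->]]]]|[x [y [xX yX xy ->]]]].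
  by rewrite subUset !sub1set => /andP[xX yX]; exists x, y.
by split; [apply/edgeP; exists x, y | rewrite subUset !sub1set xX].
Qed.

Lemma vol_edges X : vol X = #|edges_in X|.*2.
Proof.
have [n] := ubnP #|X|; elim: n X => // n IH X Xn.
have [->|/set0Pn[x xX]] := eqVneq X set0.
  rewrite /vol /dsum big_set0; apply/esym/eqP; rewrite double_eq0 cards_eq0.
  by apply/eqP/setP => e; rewrite in_set0; apply/edges_inP => -[u [v []]]; rewrite inE.
rewrite (volD1 xX) IH; last by move: Xn; rewrite (cardsD1 x) xX; nlia.
rewrite -doubleD; congr _.*2.
rewrite -(cardsID (edges_in (X :\ x)) (edges_in X)); congr (_ + _).
  apply: eq_card => e; rewrite in_setI !(inE, subsetD1); case: (e \in edges G) => //=.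
  by case: (e \subset X).
rewrite /nb -[LHS](card_in_imset (f := fun y => [set x; y])); last first.
  move=> y z; rewrite !inE => /andP[_ xy] _ /setP/(_ y); rewrite !inE eqxx orbT => /esym.
  by case/orP=> /eqP // e; rewrite e adj_irrefl in xy.
apply: eq_card => e; apply/imsetP/setDP => [[y]|[/edges_inP[u [v [uX vX uv ->]]] ne]].
  rewrite inE => /andP[yX xy] ->; split; first by apply/edges_inP; exists x, y.
  by rewrite inE subsetD1 !inE eqxx !andbF.
have : x \in [set u; v].
  apply/negPn/negP; rewrite !inE negb_or => /andP[xu xv]; case/negP: ne.
  by apply/edges_inP; exists u, v; rewrite !inE ![_ == x]eq_sym xu xv.
rewrite !inE => /orP[]/eqP->; [exists v | exists u]; rewrite ?inE ?uX ?vX //.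
  by rewrite adj_sym.
by rewrite setUC.
Qed.

Lemma conn3 S : conn S -> #|S| = 3 -> exists2 x, x \in S & S :\ x \subset [set y in S | adj x y].
Proof.
move=> cS S3; have := vol_conn cS; rewrite S3 => vS.
have [x xS nx] : exists2 x, x \in S & 1 < nb S x.
  apply: contrapT => hn; have : vol S <= #|S| * 1.
    by apply: dsum_le => x xS; rewrite leqNgt; apply/negP => nx; apply: hn; exists x.
  by rewrite S3; nlia.
exists x => //; suff /eqP<- : [set y in S | adj x y] == S :\ x by [].
rewrite eqEcard; apply/andP; split.
  apply/subsetP => y; rewrite !inE => /andP[yS xy]; rewrite yS andbT.
  by apply/eqP => e; rewrite e adj_irrefl in xy.
by move: S3; rewrite (cardsD1 x) xS -/(nb S x); nlia.
Qed.

Lemma card3_other S x : x \in S -> #|S| = 3 -> exists y z,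
  [/\ S :\ x = [set y; z], y \in S & z \in S] /\ y != z.
Proof.
move=> xS S3; have /cards2P[y [z [yz e]]] : #|S :\ x| == 2 by move: S3; rewrite (cardsD1 x) xS;
  nlia.
exists y, z; split=> //; split=> //.
  by have /setD1P[] : y \in S :\ x by rewrite e !inE eqxx.
by have /setD1P[] : z \in S :\ x by rewrite e !inE eqxx orbT.
Qed.

Lemma ngood3_centers A : ngood A 3 <= \sum_(x in A) 'C(nb A x, 2).
Proof.
pose F x := (fun B => x |: B) @: [set B : {set G} | B \subset [set y in A | adj x y] & #|B| == 2].
have cF x : #|F x| <= 'C(nb A x, 2) by rewrite (leq_trans (leq_imset_card _ _)) // cards_draws.
apply: leq_trans (_ : \sum_(x in A) #|F x| <= _); last by apply: leq_sum => x _.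
apply: leq_trans (_ : #|\bigcup_(x in A) F x| <= _); last first.
  elim/big_ind2: _ => [|m X n Y Xm Yn|//]; first by rewrite cards0.
  by apply: leq_trans (leq_add Xm Yn); case: (leq_card_setU X Y).
apply: subset_leq_card; apply/subsetP => S /good_setsP[SA cS [cnS _]].
have [x xS nx] := conn3 cnS cS; apply/bigcupP; exists x; first exact: (subsetP SA).
apply/imsetP; exists (S :\ x); last by rewrite setD1K.
rewrite inE; apply/andP; split; last by move: cS; rewrite (cardsD1 x) xS; nlia.
by apply: subset_trans nx _; apply/subsetP => y; rewrite !inE => /andP[/(subsetP SA)-> ->].
Qed.

Lemma ngood3_edges A : ngood A 3 <= 'C(#|edges_in A|, 2).
Proof.
rewrite -cards_draws; set D := [set B : {set {set G}} | _].
apply: leq_trans (_ : #|[set cover B | B in D]| <= _); last exact: leq_imset_card.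
apply: subset_leq_card; apply/subsetP => S /good_setsP[SA cS [cnS _]].
have [x xS nx] := conn3 cnS cS; have [y [z [[e yS zS] yz]]] := card3_other xS cS.
have [xy xz] : adj x y /\ adj x z.
  by move: nx; rewrite e subUset !sub1set !inE => /andP[/andP[_ ->] /andP[_ ->]].
apply/imsetP; exists [set [set x; y]; [set x; z]].
  rewrite inE subUset !sub1set; apply/andP; split; last first.
    rewrite cards2; suff -> : [set x; y] != [set x; z] by [].
    apply/eqP => /setP/(_ y); rewrite !inE eqxx orbT (negbTE yz) orbF => /esym/eqP exy.
    by rewrite exy adj_irrefl in xy.
  apply/andP; split; apply/edges_inP; [exists x, y | exists x, z]; rewrite ?(subsetP SA) //.
rewrite /cover bigcup_setU !big_set1 -(setD1K xS) e.
by apply/setP => u; rewrite !inE; do 3!case: (u == _).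
Qed.

(** Either c is the centre of the triple, between two of its neighbours, or the other two vertices
    form an edge. *)
Lemma ngood3_hub A c : c \in A -> #|[set S in good_sets A 3 | c \in S]| <= 'C(nb A c, 2) +
  #|edges_in (A :\ c)|.
Proof.
move=> cA; rewrite /nb -cards_draws.
pose F B := c |: B.
set D := [set B : {set G} | _]; set E := edges_in _.
apply: leq_trans (_ : #|F @: D| + #|F @: E| <= _); last by rewrite leq_add ?leq_imset_card.
apply: leq_trans (_ : #|(F @: D) :|: (F @: E)| <= _);
  last by case: (leq_card_setU (F @: D) (F @: E)).
apply: subset_leq_card; apply/subsetP => S /setIdP[/good_setsP[SA cS [cnS _]] cinS].
have [x xS nx] := conn3 cnS cS; rewrite inE; apply/orP.
have [ex|xc] := eqVneq x c.
  left; rewrite ex in nx; apply/imsetP; exists (S :\ c); last by rewrite /F setD1K.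
  rewrite inE; apply/andP; split; last by move: cS; rewrite (cardsD1 c) cinS; nlia.
  by apply: subset_trans nx _; apply/subsetP => y; rewrite !inE => /andP[/(subsetP SA)-> ->].
right; have [y [z [[e yS zS] yz]]] := card3_other cinS cS.
have xyz : x \in [set y; z] by rewrite -e !inE xc.
have [w [ew wS]] : exists w, S :\ c = [set x; w] /\ w \in S.
  move: xyz; rewrite !inE => /orP[]/eqP->; [by exists z | exists y; split=> //].
  by rewrite e setUC.
have wx : w != x.
  apply/eqP => ewx; move: ew; rewrite ewx setUid => ewx'.
  by move: cS; rewrite (cardsD1 c) cinS ewx' cards1.
have xw : adj x w by have := subsetP nx w; rewrite !inE wx wS => /(_ isT).
have /setD1P[wc _] : w \in S :\ c by rewrite ew !inE eqxx orbT.
apply/imsetP; exists [set x; w]; last by rewrite /F -ew setD1K.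
by apply/edges_inP; exists x, w; rewrite !inE xc wc !(subsetP SA).
Qed.

Lemma bicyclic_set_ngood3 A : bicyclic_set A -> 6 < #|A| -> ngood A 3 <= 'C(#|A|.-1, 2).+1.
Proof.
move=> bA A7; have [cA vA] := bA.
have n1 x : x \in A -> 0 < nb A x by move=> xA; apply: conn_nb_gt0 => //; nlia.
have [small|[c cinA nc]] : (forall x, x \in A -> nb A x <= 3) \/ exists2 c, c \in A & 3 < nb A c.
  have [|hn] := EM (exists2 c, c \in A & 3 < nb A c); first by right.
  by left=> x xA; rewrite leqNgt; apply/negP => nx; apply: hn; exists x.
  have H : (ngood A 3).*2 + #|A| * 3 <= 3 * vol A.
    apply: leq_trans (_ : (\sum_(x in A) 'C(nb A x, 2)) * 2 + #|A| * 3 <= _).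
      by rewrite muln2 leq_add2r leq_double ngood3_centers.
    rewrite -sum_nat_const big_distrl -big_split /vol /dsum big_distrr /=; apply: leq_sum => x xA.
    (* Termwise 2 C(d,2) + 3 <= 3d, valid for d = 1, 2, 3. *)
    by have := n1 x xA; have := small x xA; move: (nb A x) => [|[|[|[|d]]]].
  move: H; rewrite vA; case: #|A| A7 => // m m7; rewrite [m.+1.-1]/=.
  have -> : m = 6 + (m - 6) by nlia.
  by rewrite bin2D (_ : 'C(6, 2) = 15) //; move: (m - 6) (ngood A 3) => d f;
    move: ('C(d, 2)) => e; nlia.
have cAc := cardsD1 c A; rewrite cinA in cAc.
have := nb_lt cinA; rewrite cAc add1n ltnS => le.
(* Of the |A| + 1 edges, those at c are removed; with e non-neighbours of c, e + 2 edges remain. *)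
have e2 : #|edges_in (A :\ c)| = (#|A :\ c| - nb A c) + 2.
  have := vA; rewrite (volD1 cinA) vol_edges cAc => h.
  by move: h le; move: #|edges_in _| #|A :\ c| (nb A c) => a b d; nlia.
have split3 : ngood A 3 = #|[set S in good_sets A 3 | c \in S]| + ngood (A :\ c) 3.
  rewrite /ngood -(cardsID [set T : {set G} | c \in T] (good_sets A 3)); congr (_ + _).
    by apply: eq_card => T; rewrite !inE.
  by apply: eq_card => T; rewrite !inE subsetD1; case: (c \in T); rewrite ?andbF ?andbT.
have := ngood3_edges (A :\ c); rewrite e2 split3 => f1.
have [w0|w0] := posnP (#|A :\ c| - nb A c).
  move: f1; rewrite w0 => f1.
  suff : #|[set S in good_sets A 3 | c \in S]| <= 'C(#|A|.-1, 2).
    by move=> h; apply: leq_trans (leq_add h f1) _; rewrite (_ : 'C(0 + 2, 2) = 1) // addn1 cAc.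
  have -> : 'C(#|A|.-1, 2) = 'C(#|A| - #|[set c]|, 3 - #|[set c]|) by rewrite cards1 subn1.
  rewrite -card_supersets ?sub1set ?cards1 //; apply: subset_leq_card; apply/subsetP => S.
  by case/setIdP=> /good_setsP[SA cS _] cS'; rewrite inE SA cS sub1set.
have := ngood3_hub cinA; rewrite e2 [_.+1.-1]/=.
move: f1 w0 nc A7; rewrite cAc add1n; move: (ngood (A :\ c) 3) #|[set _ in _ | _]| => a b.
move: le; move: #|A :\ c| (nb A c) => m d le; have [e ->] : exists e, m = d + e.
  by exists (m - d); rewrite subnKC.
(* What remains is 3e + 2 <= de with d >= 4 and e >= 1. It fails only for d = 4, e = 1, excluded by
   d + e >= 6. *)
rewrite addKn !bin2D (_ : 'C(2, 2) = 1) //; move: ('C(d, 2)) ('C(e, 2)) => u v; clear; nia.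
Qed.

End Edges.

(** * The cop-win polynomial *)

Lemma bicyclic_bicyclic_set (G : sgraph) : bicyclic G -> bicyclic_set [set: G].
Proof.
move=> [[G0 cG] eG]; have eT : edges_in [set: G] = edges G.
  by apply/setP => e; rewrite inE subsetT andbT.
split; last by rewrite vol_edges eT eG cardsT doubleS.
split; first by rewrite -card_gt0 cardsT.
move=> X x0 x0X _ clX; apply/subsetP => y _; have /connectP[p] := cG x0 y.
elim: p x0 x0X => [|z p IH] x0 x0X /=; first by move=> _ ->.
by case/andP=> xz; apply: IH; apply: clX xz; rewrite ?inE.
Qed.

Section Count.
Variable G : sgraph.

Lemma cw_count_ngood k : cw_count G k <= ngood [set: G] k.
Proof.
apply: subset_leq_card; apply/subsetP => S; rewrite inE => /andP[/eqP cS /asboolP cw].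
by apply/good_setsP; split=> //; apply: cop_win_good.
Qed.

Lemma cw_count_bin k : cw_count G k <= 'C(#|G|, k).
Proof.
rewrite -card_draws; apply: subset_leq_card; apply/subsetP => S.
by rewrite !inE => /andP[].
Qed.

Lemma cw_count2 : cw_count G 2 <= #|edges G|.
Proof.
apply: subset_leq_card; apply/subsetP => S; rewrite inE => /andP[cS /asboolP/cop_win_good[cnS _]].
have S2 := eqP cS; have /cards2P[x [y [xy eS]]] := cS.
have /nb_gt0P[z] : 0 < nb S x by apply: conn_nb_gt0; rewrite ?S2 // eS !inE eqxx.
rewrite eS !inE => /orP[]/eqP-> xz; first by rewrite adj_irrefl in xz.
by apply/edgeP; exists x, y.
Qed.

Lemma cw_polyE :
  cw_poly G = (\poly_(k < #|G|.+1) ((0 < k) * cw_count G k)%:R)%R.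
Proof.
rewrite poly_def -(big_mkord xpredT (fun i => (((0 < i) * cw_count G i)%:R *: 'X^i)%R)).
rewrite big_ltn // mul0n GRing.scale0r GRing.add0r; apply: eq_big_nat => i /andP[i0 _].
by rewrite i0 mul1n.
Qed.

End Count.

(** * Lower bounds for the counts of B_n *)

Section BnCount.
Variable m : nat.
Let c : Bn m.+4 := @Ordinal m.+4 0 isT.
Let a : Bn m.+4 := @Ordinal m.+4 1 isT.
Let b : Bn m.+4 := @Ordinal m.+4 2 isT.
Let w : Bn m.+4 := @Ordinal m.+4 3 isT.

Lemma Bn_dominated (S : {set Bn m.+4}) k d : #|S| = k -> d \in S ->
  (forall x, x \in S -> x != d -> adj d x) ->
  S \in [set S : {set Bn m.+4} | (#|S| == k) && `[< cop_win (induced S) >]].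
Proof. by move=> cS dS dom; rewrite inE cS eqxx; apply/asboolP;
  apply: cop_win_dominated dS dom. Qed.

(** Sets through c are dominated by c; E collects further sets, dominated by a, needed only for k =
    2 and k = 3. *)
Lemma Bn_count k (E : {set {set Bn m.+4}}) : 0 < k ->
  (forall S, S \in E -> [/\ #|S| = k, c \notin S, a \in S & forall x, x \in S -> x != a -> adj a
    x]) ->
  'C(m.+3, k.-1) + #|E| <= cw_count (Bn m.+4) k.
Proof.
move=> k0 hE;
  pose D := [set S : {set Bn m.+4} | [&& S \subset [set: Bn m.+4], #|S| == k & [set c] \subset
    S]].
have cD : #|D| = 'C(m.+3, k.-1).
  by rewrite card_supersets ?subsetT ?cards1 // cardsT card_ord subn1 subn1.
have dDE : [disjoint D & E].
  apply/pred0P => S /=; apply/negP => /andP[]; rewrite inE sub1set => /and3P[_ _ cS] /hE[_].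
  by rewrite cS.
have <- : #|D :|: E| = 'C(m.+3, k.-1) + #|E| by rewrite cardsU (disjoint_setI0 dDE) cards0 subn0
  cD.
apply: subset_leq_card; apply/subsetP => S /setUP[|/hE[cS _ aS dom]];
  last exact: Bn_dominated dom.
rewrite [_ \in D]inE sub1set => /and3P[_ /eqP cS cS']; apply: (Bn_dominated cS cS') => x _ xc.
apply/orP; left; apply/orP; left; rewrite /= ; by apply: contraNneq xc => x0; apply/eqP/val_inj.
Qed.

Lemma Bn_count1 : cw_count (Bn m.+4) 1 = m.+4.
Proof.
apply/eqP; rewrite eqn_leq; apply/andP; split.
  by have := cw_count_bin (Bn m.+4) 1; rewrite bin1 card_ord.
rewrite -{1}[m.+4]card_ord -(bin1 #|_|) -card_draws; apply: subset_leq_card; apply/subsetP => S.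
rewrite inE => /cards1P[x ->]; apply: (@Bn_dominated _ _ x); rewrite ?cards1 ?inE //.
by move=> y /set1P->; rewrite eqxx.
Qed.

Lemma Bn_count2 : m.+4.+1 <= cw_count (Bn m.+4) 2.
Proof.
have := @Bn_count 2 [set [set a; b]; [set a; w]] isT.
rewrite cards2 bin1 (_ : [set a; b] != [set a; w]) ?addn2 => [|]; last first.
  by apply/eqP => /setP/(_ b); rewrite !inE.
by apply=> S; rewrite !inE => /orP[]/eqP->; rewrite cards2 !inE; split=> // x;
  rewrite !inE => /orP[]/eqP->.
Qed.

Lemma Bn_count3 : ('C(m.+3, 2)).+1 <= cw_count (Bn m.+4) 3.
Proof.
have := @Bn_count 3 [set [set a; b; w]] isT; rewrite cards1 addn1; apply=> S.
rewrite inE => /eqP->; rewrite setUC cardsU1 cards2 !inE; split=> // x.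
by rewrite !inE => /orP[|/orP[]]/eqP->.
Qed.

End BnCount.

Theorem theorem4p8 (G : sgraph) (n : nat) (order_G : #|G| = n)
    (n_ge7 : (7 <= n)%N) (bicyclic_G : bicyclic G) :
  cw_poly G ⪯ cw_poly (Bn n).
Proof.
have bG := bicyclic_bicyclic_set bicyclic_G; have [_ eG] := bicyclic_G.
have count_le k : cw_count G k * (0 < k) <= cw_count (Bn n) k.
  case: n order_G n_ge7 => [|[|[|[|m]]]] // cG m7; case: k => [|k]; first by rewrite muln0.
  rewrite muln1; have cT : #|[set: G]| = m.+4 by rewrite cardsT.
  case: k => [|[|[|k]]].
  - by rewrite Bn_count1 -[m.+4]bin1 -cG cw_count_bin.
  - by apply: leq_trans (cw_count2 G) (leq_trans _ (Bn_count2 m)); rewrite eG cG.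
  - apply: leq_trans (cw_count_ngood G 3) (leq_trans _ (Bn_count3 m)).
    by have := bicyclic_set_ngood3 bG; rewrite cT; apply.
  apply: leq_trans (cw_count_ngood G _) _.
  have := @Bn_count m k.+4 set0 isT; rewrite cards0 addn0 => /(_ _)/(leq_trans _); apply;
    last by move=> S; rewrite inE.
  by case: (@bicyclic_set_ngood G [set: G] k.+4 bG isT) => [|[]]; rewrite cT // => e; move: m7;
    rewrite e.
have cB : #|Bn n| = n by rewrite card_ord.
(* The whole of B_n is cop-win, so its polynomial has degree n, which settles the size condition. *)
have lead : 0 < cw_count (Bn n) n.
  case: n n_ge7 {order_G count_le cB} => [|[|[|[|m]]]] // _.
  have := @Bn_count m m.+4 set0 isT; rewrite cards0 addn0 binn; apply=> S; by rewrite inE.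
rewrite !cw_polyE order_G cB; split=> [|k].
  rewrite [leqRHS]size_poly_eq ?size_poly //= Num.Theory.pnatr_eq0 -lt0n muln_gt0 lead andbT lt0b.
  exact: leq_trans n_ge7.
rewrite !coef_poly; case: ifP => // _; rewrite Num.Theory.ler_nat.
by have := count_le k; case: k => [|k]; rewrite ?mul0n // !mul1n muln1.
Qed.
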